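(* Let $\Phi$ be a real-valued invariant of closed combinatorial manifolds under PL isomorphisms (that is, $\Phi(M,\xi)=\Phi(M',\xi')$ whenever the closed combinatorial manifolds $(M,\xi)$ and $(M',\xi')$ are PL-homeomorphic) that depends only on the number of simplices in each dimension (that is, $\Phi(M,\xi)=\Phi(M',\xi')$ whenever the closed combinatorial manifolds $(M,\xi)$ and $(M',\xi')$ have the same $\mathbf{f}$-vector). If $(M_1^n,\xi_1)$ and $(M_2^n,\xi_2)$ are two closed combinatorial $n$-manifolds with the same Euler characteristic, $\chi(M_1^n)=\chi(M_2^n)$, then $\Phi(M_1^n,\xi_1)=\Phi(M_2^n,\xi_2)$.
   Context: A combinatorial $n$-manifold $(M^n,\xi)$ is a topological $n$-manifold $M^n$ together with a triangulation $\xi$ by a simplicial complex (taken up to simplicial isomorphism) in which the link of every vertex is a PL $(n-1)$-sphere (or a PL $(n-1)$-ball, for vertices on the boundary); it is closed if $M^n$ is compact without boundary. Manifolds are not assumed connected. For compact $M^n$, $f_k(M^n,\xi)$ is the number of $k$-simplices of $\xi$ and the $\mathbf{f}$-vector is $\mathbf{f}(M^n,\xi)=(f_0(M^n,\xi),\dots,f_n(M^n,\xi))$. $\chi$ denotes the Euler characteristic. PL means piecewise linear. *)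

(* Defs.v *)
From HB Require Import structures.
From mathcomp Require Import all_boot all_order all_algebra.
From mathcomp Require Import all_classical all_reals all_analysis.

Set Implicit Arguments.
Unset Strict Implicit.
Unset Printing Implicit Defensive.

Import Order.TTheory GRing.Theory Num.Theory.
Import numFieldNormedType.Exports.

Local Open Scope classical_set_scope.
Local Open Scope ring_scope.

(** Piecewise linear topology of subsets of the spaces R^m. *)

(* The maps are total; only their values on [A], resp. [B], matter. *)
Definition mutually_inverse {S T : Type} (A : set S) (B : set T)
    (f : S -> T) (g : T -> S) : Prop :=
  [/\ forall x, A x -> B (f x), forall y, B y -> A (g y),
      forall x, A x -> g (f x) = x & forall y, B y -> f (g y) = y].

Definition homeomorphic {S T : topologicalType} (A : set S) (B : set T) : Prop :=
  exists (f : S -> T) (g : T -> S),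
    [/\ mutually_inverse A B f g, {within A, continuous f}
      & {within B, continuous g}].

(* The Hausdorff and second countability axioms hold for every subset of R^m. *)
Definition topological_manifold {R : realType} (n : nat) {m : nat}
    (A : set 'rV[R]_m) : Prop :=
  forall x, A x -> exists U : set 'rV[R]_m,
    [/\ open U, U x & homeomorphic (A `&` U) [set: 'rV[R]_n]].

Definition convex_hull {R : realType} {m k : nat} (p : 'I_k -> 'rV[R]_m) :
    set 'rV[R]_m :=
  [set x | exists t : 'I_k -> R,
    [/\ forall i, 0 <= t i, \sum_i t i = 1 & x = \sum_i t i *: p i]].

Definition polytope {R : realType} {m : nat} (P : set 'rV[R]_m) : Prop :=
  exists (k : nat) (p : 'I_k -> 'rV[R]_m), P = convex_hull p.

Definition affine_on {R : realType} {m m' : nat} (P : set 'rV[R]_m)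
    (f : 'rV[R]_m -> 'rV[R]_m') : Prop :=
  forall x y (t : R), P x -> P y -> 0 <= t <= 1 ->
    f (t *: x + (1 - t) *: y) = t *: f x + (1 - t) *: f y.

(* A continuous map is PL on [A] if [A] is a finite union of convex polytopes
   on each of which the map is affine. *)
Definition PL_on {R : realType} {m m' : nat} (A : set 'rV[R]_m)
    (f : 'rV[R]_m -> 'rV[R]_m') : Prop :=
  {within A, continuous f} /\
  exists (k : nat) (P : 'I_k -> set 'rV[R]_m),
    A = \bigcup_i P i /\ forall i, polytope (P i) /\ affine_on (P i) f.

Definition PL_homeomorphic {R : realType} {m m' : nat}
    (A : set 'rV[R]_m) (B : set 'rV[R]_m') : Prop :=
  exists (f : 'rV[R]_m -> 'rV[R]_m') (g : 'rV[R]_m' -> 'rV[R]_m),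
    [/\ mutually_inverse A B f g, PL_on A f & PL_on B g].

(** Finite simplicial complexes, given by their sets of nonempty simplices.
    An element [v] of [V] is a vertex only if [[set v]] is a simplex. *)

Definition simplicial_complex {V : finType} (K : {set {set V}}) : Prop :=
  finset.set0 \notin K /\
  forall s t : {set V},
    s \in K -> t \subset s -> t != finset.set0 -> t \in K.

Definition link {V : finType} (K : {set {set V}}) (v : V) : {set {set V}} :=
  [set s in K | (v \notin s) && (v |: s \in K)]%SET.

(* The faces of the standard [n]-simplex other than itself: a triangulated
   [(n-1)]-sphere, empty when [n = 0]. *)
Definition simplex_boundary (n : nat) : {set {set 'I_n.+1}} :=
  [set s | (s != finset.set0) && (s != [set: 'I_n.+1])]%SET.

(* The barycentric coordinate of [x] at the vertex [v] is its matrix entry at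
   [enum_rank v]. *)
Definition realization (R : realType) {V : finType} (K : {set {set V}}) :
    set 'rV[R]_#|V| :=
  [set x | [/\ forall v, 0 <= x ord0 (enum_rank v),
      \sum_v x ord0 (enum_rank v) = 1
    & [set v | x ord0 (enum_rank v) != 0]%SET \in K]].
Arguments realization R {V} K.

(* [L] triangulates a PL sphere of dimension [n - 1]. *)
Definition PL_sphere_pred (R : realType) (n : nat) {V : finType}
    (L : {set {set V}}) : Prop :=
  PL_homeomorphic (realization R L) (realization R (simplex_boundary n)).
Arguments PL_sphere_pred R n {V} L.

(** Closed combinatorial [n]-manifolds. The manifold is the realization of the
    triangulation, and compactness amounts to finiteness of the complex. It is
    nonempty, not necessarily connected. *)

Record closed_manifold (R : realType) (n : nat) := ClosedManifold {
  vertex : finType;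
  simplices : {set {set vertex}};
  closed_manifold_complex : simplicial_complex simplices;
  closed_manifold_nonempty : simplices != finset.set0;
  closed_manifold_top : topological_manifold n (realization R simplices);
  closed_manifold_link : forall v : vertex, [set v]%SET \in simplices ->
    PL_sphere_pred R n (link simplices v)
}.

Definition PL_isomorphic {R : realType} {n n' : nat}
    (M : closed_manifold R n) (M' : closed_manifold R n') : Prop :=
  PL_homeomorphic (realization R (simplices M)) (realization R (simplices M')).

Definition f_number {R : realType} {n : nat} (M : closed_manifold R n)
    (k : nat) : nat :=
  #|[set s in simplices M | #|s| == k.+1]%SET|.

Definition f_vector {R : realType} {n : nat} (M : closed_manifold R n) :
    seq nat :=
  mkseq (f_number M) n.+1.

Definition euler_characteristic {R : realType} {n : nat}
    (M : closed_manifold R n) : int :=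
  \sum_(s in simplices M) (-1) ^+ #|s|.-1.

(* Main.v *)
(* [M1] and [M2] are changed by stellar subdivisions, which preserve the PL type,
   until their f-vectors coincide.

   Write [F(x)] for the sum of [x^|s|] over the simplices [s].  The links are PL
   spheres, so each simplex [s] satisfies the local Euler relation: the sum of
   [(-1)^|t|] over the simplices [t] containing [s] is [(-1)^(n+1)].  Summing
   over [s] gives the Dehn-Sommerville relations
   [F(-1-x) = (-1)^(n+1) F(x) - chi].  Hence the difference [a] of the two
   polynomials satisfies [a(-1-x) = (-1)^(n+1) a(x)], [a(0) = 0] and
   [deg a <= n+1], and so it is an integral combination of the polynomials
   [y s_j], where [y = x(1+x)], [e_k = (1+x)^k - x^k], [s_j = e_j e_(n+1-j)]:
   indeed [s_(j+1) - s_j = y^j e_(n-2j)], and subtracting a multiple of [e_n]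
   from [a / y] makes it divisible by [y] again.  Subdividing a facet adds
   [y e_n = y s_1] to [F]; subdividing then the join of the new vertex with a
   face of [j] vertices of that facet adds [y s_j].  Applying these moves to
   [M1] or to [M2] thus changes [a] by any element of the lattice, in
   particular to [0].

   The local Euler relation rests on the PL invariance of Euler
   characteristics, and this on the existence of a valuation on bounded
   relatively open convex sets with value [(-1)^dim], obtained by slicing along
   one coordinate after the other.  A PL map decomposes its graph into such
   sets, which project injectively and affinely to source and target. *)

From HB Require Import structures.
From mathcomp Require Import all_boot all_order all_algebra.
From mathcomp Require Import all_classical all_reals all_analysis.
From mathcomp Require Import lra ring zify.
Require Import Defs.

Set Implicit Arguments.
Unset Strict Implicit.
Unset Printing Implicit Defensive.

Import Order.TTheory GRing.Theory Num.Theory.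
Import numFieldNormedType.Exports.

Local Open Scope classical_set_scope.
Local Open Scope ring_scope.

(** * Euler characteristic of cells *)

(** The cells that decompose the graph of a PL map may overlap, so characteristics are computed by
    inclusion and exclusion over their intersections, which are again cells. The same count serves
    globally and locally: cutting all cells with a small open box around a point leaves only the
    simplices around that point. A PL homeomorphism does not carry boxes to boxes, but it preserves
    which intersections of pieces have the point in their closure, and for small boxes this is all
    that the count sees.

    Only the links of vertices are given as spheres; the local relation at a larger simplex is read
    off in the link of one of its vertices. The subdivisions are chosen so that the link of the new
    vertex is explicit: the boundary of a simplex at a facet, and a join of two such boundaries
    afterwards. A subdivision can only add its polynomial, never remove it; since two manifolds are
    compared, removal on one side is replaced by addition on the other. *)

Lemma exists_common_small (R : realFieldType) (I : finType) (P : I -> R -> Prop) :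
  (forall i, exists2 e, 0 < e & forall d, 0 < d <= e -> P i d) ->
  exists2 e, 0 < e & forall i d, 0 < d <= e -> P i d.
Proof.
move=> h; suff [e e0 he] : exists2 e, 0 < e &
    forall i, i \in enum I -> forall d, 0 < d <= e -> P i d.
  by exists e => // i; apply: he; rewrite mem_enum.
elim: (enum I) => [|i s [e e0 he]]; first by exists 1.
have [e' e'0 he'] := h i; exists (Num.min e e'); first by rewrite lt_min e0.
move=> j; rewrite inE => /orP[/eqP->|js] d; rewrite le_min => /and3P[d0 de de'].
  by apply: he'; rewrite d0.
by apply: he => //; rewrite d0.
Qed.

(** Depending on [b], [J] is a point or an open interval. A point is met at [t] and no longer right
    of it, which gives 1; an open interval is missed at its infimum and met right of it, which gives
    -1. An open interval has no jump at its right end, so only left ends count. *)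
Lemma interval_jump (R : realType) (J : set R) (b : bool) (M t : R) :
  (forall x, J x -> - M <= x) ->
  (~~ b -> forall x y, J x -> J y -> x = y) ->
  (forall x y z, J x -> J y -> x <= z <= y -> J z) ->
  (b -> forall x, J x -> exists2 e, 0 < e & J (x + e) /\ J (x - e)) ->
  exists2 e, 0 < e & forall d, 0 < d <= e ->
    (`[< J t >] : int) - (`[< J (t + d) >] : int) =
    if `[< J !=set0 >] && (inf J == t) then (-1) ^+ b else 0 :> int.
Proof.
move=> bnd pt cvx opn.
case: (asboolP (J !=set0)) => [[x Jx]|J0]; last first.
  exists 1 => // d _ /=.
  have JF s : `[< J s >] = false by apply: asboolF => Js; apply: J0; exists s.
  by rewrite !JF subrr.
have lbJ : has_lbound J by exists (- M) => y /bnd.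
have ilb y : J y -> inf J <= y by exact: ge_inf.
case: b pt opn => pt opn; last first.
  have Jxe y : J y -> y = x by move=> Jy; exact: pt.
  have -> : inf J = x.
    rewrite (_ : J = [set x]) ?inf1//; apply/seteqP; split => y /=; first exact: Jxe.
    by move=> ->.
  have [tx|xt|->] := ltgtP t x.
  - exists ((x - t) / 2); first lra.
    move=> d /andP[d0 d1]; have d2 : t + d < x by lra.
    by rewrite !asboolF ?subrr// => /Jxe ?; lra.
  - exists 1 => // d /andP[d0 d1].
    by rewrite !asboolF ?subrr// => /Jxe ?; lra.
  - exists 1 => // d /andP[d0 d1] /=; rewrite asboolT//.
    by rewrite asboolF ?subr0// => /Jxe ?; lra.
have {}opn := opn isT; have ilt y : J y -> inf J < y.
  by move=> /opn[e e0 [_ /ilb]] h; apply: le_lt_trans h _; rewrite gtrBl.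
have [ti|it|->] /= := ltgtP t (inf J).
- exists ((inf J - t) / 2); first by rewrite divr_gt0// subr_gt0.
  move=> d /andP[d0 d1]; have d2 : t + d < inf J by lra.
  by rewrite !asboolF ?subrr// => /ilb ?; lra.
- have [y Jy yt] := inf_lt (ex_intro _ _ Jx) it.
  have [Jt|Jt] := pselect (J t).
    have [e e0 [Je _]] := opn _ Jt; exists e => // d /andP[d0 d1].
    by rewrite !asboolT// ?subrr//; apply: (cvx t (t + e)) => //; lra.
  exists 1 => // d /andP[d0 d1]; rewrite !asboolF ?subrr// => Jd.
  by apply: Jt; apply: (cvx y (t + d)) => //; lra.
- have ix := ilt _ Jx; exists (x - inf J); first by rewrite subr_gt0.
  move=> d /andP[d0 d1]; rewrite asboolF; last by move=> /ilt; rewrite ltxx.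
  rewrite asboolT//; have id : inf J < inf J + d by lra.
  have [y Jy yt] := inf_lt (ex_intro _ _ Jx) id.
  by apply: (cvx y x) => //; lra.
Qed.

(* The Euler characteristic of a constructible function [g] on the line is the
   sum of the jumps [g t - g (t+)]; an interval contributes at its left end. *)
Lemma euler_line (R : realType) (I : finType) (J : I -> set R) (b : I -> bool)
    (c : I -> int) (M : R) :
  (forall i x, J i x -> - M <= x) ->
  (forall i, ~~ b i -> forall x y, J i x -> J i y -> x = y) ->
  (forall i x y t, J i x -> J i y -> x <= t <= y -> J i t) ->
  (forall i, b i -> forall x, J i x ->
     exists2 e, 0 < e & J i (x + e) /\ J i (x - e)) ->
  (forall t, \sum_(i | `[< J i t >]) c i = 0) ->
  \sum_(i | `[< J i !=set0 >]) (-1) ^+ b i * c i = 0.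
Proof.
move=> bnd pt cvx opn sum0.
have jump t : \sum_(i | `[< J i !=set0 >] && (inf (J i) == t)) (-1) ^+ b i * c i = 0.
  have [e e0 he] := exists_common_small (fun i =>
    interval_jump t (bnd i) (pt i) (@cvx i) (opn i)).
  have {he}he i := he i e; rewrite e0 lexx in he.
  have sE : \sum_(i | `[< J i t >]) c i - \sum_(i | `[< J i (t + e) >]) c i = 0.
    by rewrite !sum0 subrr.
  rewrite -[RHS]sE [in RHS]big_mkcond [X in _ - X]big_mkcond /= -sumrB big_mkcond.
  apply: eq_bigr => i _.
  transitivity ((if `[< J i !=set0 >] && (inf (J i) == t) then (-1) ^+ b i else 0) * c i).
    by case: ifP; rewrite ?mul0r.
  rewrite -he// mulrBl; by do 2 case: asbool; rewrite ?mul1r ?mul0r.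
(* Each interval is counted at the one value of [s] that is its infimum, and the contributions at
   each value cancel by [jump]. *)
pose s := undup [seq inf (J i) | i <- enum I].
have -> : \sum_(i | `[< J i !=set0 >]) (-1) ^+ b i * c i =
  \sum_(i | `[< J i !=set0 >]) \sum_(t <- s | t == inf (J i)) (-1) ^+ b i * c i.
  apply: eq_bigr => i _; rewrite -big_filter filter_pred1_uniq ?undup_uniq ?big_seq1//.
  by rewrite mem_undup (map_f (fun i => inf (J i)))// mem_enum.
rewrite (exchange_big_dep xpredT) //= big1// => t _.
by rewrite -[RHS](jump t); apply: eq_bigl => i; rewrite [t == _]eq_sym.
Qed.

Definition convex_set (R : realType) m (C : set 'rV[R]_m) : Prop :=
  forall x y (t : R), C x -> C y -> 0 <= t <= 1 -> C (t *: x + (1 - t) *: y).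

(* A relatively open convex set, [W] being the row space of the directions of
   its affine hull. *)
Definition cell (R : realType) m (W : 'M[R]_m) (C : set 'rV[R]_m) : Prop :=
  [/\ convex_set C,
      forall x y, C x -> C y -> (y - x <= W)%MS
    & forall x (w : 'rV_m), C x -> (w <= W)%MS ->
        exists2 e, 0 < e & C (x + e *: w)].

Section Cells.
Variables (R : realType) (m : nat).
Implicit Types (W : 'M[R]_m) (C : set 'rV[R]_m).

Lemma cell_segment W C x (w : 'rV_m) : cell W C -> C x -> (w <= W)%MS ->
  exists2 e, 0 < e & forall d, 0 <= d <= e -> C (x + d *: w).
Proof.
move=> [cvx _ opn] Cx wW; have [e e0 Ce] := opn _ _ Cx wW; exists e => // d de.
have -> : x + d *: w = (d / e) *: (x + e *: w) + (1 - d / e) *: x.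
  rewrite scalerDr scalerBl scale1r scalerA divfK ?gt_eqF//.
  by rewrite addrAC addrCA subrr addr0 addrC.
apply: cvx => //; have [d0 d1] := andP de.
by rewrite divr_ge0 ?(ltW e0)// ler_pdivrMr ?mul1r.
Qed.

Lemma convex_setI C C' : convex_set C -> convex_set C' -> convex_set (C `&` C').
Proof. by move=> h h' x y t [Cx Cx'] [Cy Cy'] t01; split; [exact: h|exact: h']. Qed.

Lemma cellI W W' C C' : cell W C -> cell W' C' ->
  cell (W :&: W')%MS (C `&` C').
Proof.
move=> cC cC'; have [cvx dir opn] := cC; have [cvx' dir' opn'] := cC'.
split; first exact: convex_setI.
  by move=> x y [Cx Cx'] [Cy Cy']; rewrite sub_capmx dir ?dir'.
move=> x w [Cx Cx']; rewrite sub_capmx => /andP[wW wW'].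
have [e e0 he] := cell_segment cC Cx wW.
have [e' e'0 he'] := cell_segment cC' Cx' wW'.
exists (Num.min e e'); first by rewrite lt_min e0.
have e''0 : 0 <= Num.min e e' by rewrite le_min !ltW.
by split; [apply: he|apply: he']; rewrite e''0 ge_min lexx ?orbT.
Qed.

Lemma cellT : cell 1%:M [set: 'rV[R]_m].
Proof. by split => // [x y _ _|x w _ _]; [rewrite submx1|exists 1]. Qed.

Lemma cell_hyperplane (a : 'cV[R]_m) (t : R) :
  cell (kermx a) [set x : 'rV_m | x *m a = t%:M].
Proof.
split => [x y u /= xa ya _|x y /= xa ya|x w /= xa /sub_kermxP wa].
- by rewrite mulmxDl -!scalemxAl xa ya -scalerDl subrKC scale1r.
- by apply/sub_kermxP; rewrite mulmxBl xa ya subrr.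
- by exists 1 => //; rewrite scale1r mulmxDl xa wa addr0.
Qed.

Lemma cell_box (x : 'rV[R]_m) (d : R) :
  cell 1%:M [set y : 'rV_m | forall j, `|y ord0 j - x ord0 j| < d].
Proof.
split => [y z t hy hz /andP[t0 t1] j|y z _ _|y w hy _]; rewrite ?submx1//.
- rewrite !mxE; have -> : t * y ord0 j + (1 - t) * z ord0 j - x ord0 j =
     t * (y ord0 j - x ord0 j) + (1 - t) * (z ord0 j - x ord0 j) by ring.
  apply: le_lt_trans (ler_normD _ _) _; rewrite !normrM (ger0_norm t0).
  have /ger0_norm-> : 0 <= 1 - t by rewrite subr_ge0.
  have := hy j; have := hz j; set p := `|_|; set q := `|_| => pd qd.
  have [->|t'] := eqVneq t 0; first lra.
  have tp : 0 < t by rewrite lt_def t'.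
  have h1 : t * q < t * d by rewrite ltr_pM2l.
  have h2 : (1 - t) * p <= (1 - t) * d by rewrite ler_wpM2l ?subr_ge0// ltW.
  by lra.
- have [|e e0 he] := @exists_common_small R 'I_m (fun j e =>
     `|y ord0 j + e * w ord0 j - x ord0 j| < d).
    move=> j; have hj := hy j; pose r := d - `|y ord0 j - x ord0 j|.
    have r0 : 0 < r by rewrite subr_gt0.
    have n0 : 0 < `|w ord0 j| + 1 by rewrite ltr_wpDl.
    exists (r / (`|w ord0 j| + 1)); first by rewrite divr_gt0.
    move=> e /andP[e0 e1]; rewrite addrAC.
    apply: le_lt_trans (ler_normD _ _) _; rewrite -ltrBrDl.
    rewrite normrM gtr0_norm//; move: e1; rewrite ler_pdivlMr// => e1.
    by apply: lt_le_trans e1; rewrite ltr_pM2l// ltrDl.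
  by exists e => // j; rewrite !mxE; apply: he; rewrite e0 lexx.
Qed.

Lemma rank_capmx1 W : \rank (W :&: 1%:M)%MS = \rank W.
Proof. by rewrite capmx1. Qed.

End Cells.

Lemma cell_image (R : realType) m p (W : 'M[R]_m) (C : set 'rV[R]_m)
    (A : 'M[R]_(m, p)) : cell W C ->
  cell (<<W *m A>>%MS) [set x *m A | x in C].
Proof.
move=> [cvx dir opn]; split.
- move=> _ _ t [x Cx <-] [y Cy <-] t01.
  by exists (t *: x + (1 - t) *: y); [exact: cvx|rewrite mulmxDl -!scalemxAl].
- by move=> _ _ [x Cx <-] [y Cy <-]; rewrite genmxE -mulmxBl submxMr// dir.
- move=> _ w [x Cx <-]; rewrite genmxE => /submxP[u ->].
  have [e e0 Ce] := opn x (u *m W) Cx (submxMl _ _).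
  by exists e => //; exists (x + e *: (u *m W)); rewrite // mulmxDl -scalemxAl mulmxA.
Qed.

(** A direction of [W] killed by [A] would move a point of [C] inside [C] without moving its
    image. *)
Lemma rank_cell_image (R : realType) m p (W : 'M[R]_m) (C : set 'rV[R]_m)
    (A : 'M[R]_(m, p)) : cell W C -> C !=set0 ->
  {in C &, injective (fun x => x *m A)} -> \rank (<<W *m A>>%MS) = \rank W.
Proof.
move=> [cvx dir opn] [x Cx] inj; rewrite mxrank_gen; apply/mxrank_injP.
rewrite -submx0; apply/row_subP => i; set w := row i _.
have : (w <= W :&: kermx A)%MS by exact: row_sub.
rewrite sub_capmx => /andP[wW /sub_kermxP wA].
have [e e0 Ce] := opn x w Cx wW.
have : x + e *: w = x by apply: inj; rewrite ?inE// mulmxDl -scalemxAl wA scaler0 addr0.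
rewrite -[RHS]addr0 => /addrI/eqP; rewrite scaler_eq0 gt_eqF//= => /eqP ->.
exact: sub0mx.
Qed.

(** This is the well-definedness of the valuation: every linear relation between indicator functions
    of cells, with weights [c], persists when each indicator is replaced by the sign of the
    dimension. Empty cells are left out since their [W] is arbitrary. *)
Lemma euler_cells (R : realType) m (I : finType) (W : I -> 'M[R]_m)
    (C : I -> set 'rV[R]_m) (c : I -> int) (M : R) :
  (forall i, cell (W i) (C i)) ->
  (forall i x j, C i x -> - M <= x ord0 j) ->
  (forall x, \sum_(i | `[< C i x >]) c i = 0) ->
  \sum_(i | `[< C i !=set0 >]) (-1) ^+ \rank (W i) * c i = 0.
Proof.
(* The coordinates from [k] on are frozen at those of [a]; the induction slices along the last free
   one. *)
suff H k : (k <= m)%N -> forall (a : 'rV[R]_m) (W : I -> 'M[R]_m) C,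
    (forall i, cell (W i) (C i)) ->
    (forall i x j, C i x -> - M <= x ord0 j) ->
    (forall i x, C i x -> forall j : 'I_m, (k <= j)%N -> x ord0 j = a ord0 j) ->
    (forall x, \sum_(i | `[< C i x >]) c i = 0) ->
    \sum_(i | `[< C i !=set0 >]) (-1) ^+ \rank (W i) * c i = 0.
  move=> cC bnd sum0; apply: (H m (leqnn m) 0) => // i x _ j.
  by rewrite leqNgt ltn_ord.
elim: k => [|k IH] km a {}W {}C cC bnd fixed sum0.
  have Ca i x : C i x -> x = a.
    by move=> Cx; apply/rowP => j; exact: (fixed i x Cx).
  rewrite -[RHS](sum0 a); apply: eq_big => [i|i /asboolP[x Cx]].
    apply/asboolP/asboolP => [[x Cx]|]; last by exists a.
    by rewrite -(Ca _ _ Cx).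
  suff -> : W i = 0 by rewrite mxrank0 expr0 mul1r.
  have [_ _ opn] := cC i; apply/row_matrixP => r; rewrite row0.
  have [e e0 Ce] := opn _ _ Cx (row_sub r (W i)).
  move/eqP: (etrans (Ca _ _ Ce) (esym (Ca _ _ Cx))).
  by rewrite -subr_eq0 addrAC subrr add0r scaler_eq0 gt_eqF//= => /eqP.
pose j0 := Ordinal km; pose A : 'cV[R]_m := delta_mx j0 ord0.
have mulA (x : 'rV_m) : x *m A = (x ord0 j0)%:M.
  by rewrite [LHS]mx11_scalar -colE mxE.
pose W' i := (W i :&: kermx A)%MS.
pose J i := [set x ord0 j0 | x in C i].
(* [b i] tells whether the projection of the cell to the coordinate [j0] is an open interval or a
   point. The slices have the directions [W'], so the dimension splits into that of the projection
   and that of a slice. *)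
pose b i := W i *m A != 0.
have rankE i : \rank (W i) = (b i + \rank (W' i))%N.
  rewrite -(mxrank_mul_ker (W i) A); congr addn; rewrite /b.
  by have := rank_leq_col (W i *m A); rewrite -mxrank_eq0; case: (\rank _) => [|[]].
have -> : \sum_(i | `[< C i !=set0 >]) (-1) ^+ \rank (W i) * c i =
   \sum_(i | `[< J i !=set0 >]) (-1) ^+ b i * ((-1) ^+ \rank (W' i) * c i).
  apply: eq_big => [i|i _]; last by rewrite rankE exprD mulrA.
  apply/asboolP/asboolP => [[x Cx]|[_ [x Cx _]]]; last by exists x.
  by exists (x ord0 j0); exists x.
apply: (@euler_line R I J b _ M).
- by move=> i _ [x Cx <-]; exact: bnd Cx.
- move=> i /negPn/eqP WA _ _ [x Cx <-] [y Cy <-].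
  have [_ dir _] := cC i; have /submxP[u uE] := dir _ _ Cy Cx.
  have : (x - y) *m A = 0 by rewrite uE -mulmxA WA mulmx0.
  rewrite mulA => /matrixP/(_ ord0 ord0); rewrite !mxE/= mulr1n => /eqP.
  by rewrite subr_eq0 => /eqP.
- move=> i _ _ t [x Cx <-] [y Cy <-] /andP[xt ty].
  have [cvx _ _] := cC i.
  have [xy|xy] := leP (y ord0 j0) (x ord0 j0).
    have -> : t = x ord0 j0 by apply/eqP; rewrite eq_le xt (le_trans ty xy).
    by exists x.
  have yx : y ord0 j0 - x ord0 j0 != 0 by rewrite subr_eq0 gt_eqF.
  pose u := (y ord0 j0 - t) / (y ord0 j0 - x ord0 j0).
  exists (u *: x + (1 - u) *: y); last by rewrite !mxE /u; field.
  apply: cvx => //; rewrite divr_ge0 ?subr_ge0//; last exact: ltW.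
  by rewrite ler_pdivrMr ?subr_gt0// mul1r lerD2l lerN2.
- move=> i bi _ [x Cx <-].
  have [r Wr] : exists r, W i r j0 != 0.
    case: (pickP (fun r => W i r j0 != 0)) => [r ?|W0]; first by exists r.
    case/negP: bi; apply/eqP/colP => r; have /negbFE/eqP := W0 r.
    by rewrite -colE !mxE.
  have [w wW wj] : exists2 w : 'rV_m, (w <= W i)%MS & w ord0 j0 = 1.
    exists ((W i r j0)^-1 *: row r (W i)); first by rewrite scalemx_sub ?row_sub.
    by rewrite !mxE mulVf.
  have [e e0 he] := cell_segment (cC i) Cx wW.
  have [|e' e'0 he'] := cell_segment (w := - w) (cC i) Cx; first by rewrite eqmx_opp.
  exists (Num.min e e'); first by rewrite lt_min e0.
  have m0 : 0 <= Num.min e e' by rewrite le_min !ltW.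
  split.
    exists (x + Num.min e e' *: w); last by rewrite !mxE wj mulr1.
    by apply: he; rewrite m0 ge_min lexx.
  exists (x + Num.min e e' *: - w); last by rewrite !mxE wj mulrN mulr1.
  by apply: he'; rewrite m0 ge_min lexx orbT.
- move=> t; pose a' := \row_j (if j == j0 then t else a ord0 j).
  pose C' i := C i `&` [set x | x *m A = t%:M].
  have := IH (ltnW km) a' W' C' _ _ _ _.
  have -> : \sum_(i | `[< C' i !=set0 >]) (-1) ^+ \rank (W' i) * c i =
     \sum_(i | `[< J i t >]) (-1) ^+ \rank (W' i) * c i.
    apply: eq_bigl => i; apply/asboolP/asboolP => [[x [Cx /=]]|[x Cx xt]].
      rewrite mulA => /matrixP/(_ ord0 ord0); rewrite !mxE/= !mulr1n => xt.
      by exists x.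
    by exists x; split => //=; rewrite mulA xt.
  apply.
  + by move=> i; apply: cellI => //; exact: cell_hyperplane.
  + by move=> i x j [/bnd].
  + move=> i x [Cx /=]; rewrite mulA => /matrixP/(_ ord0 ord0); rewrite !mxE/= !mulr1n => xt.
    move=> j kj; rewrite mxE; case: eqVneq => [->//|jj0].
    apply: (fixed i x Cx); rewrite ltn_neqAle kj andbT eq_sym.
    by apply: contra jj0 => /eqP jk; apply/eqP/val_inj.
  + move=> x; have [xt|xt] := pselect (x *m A = t%:M).
      rewrite -[RHS](sum0 x); apply: eq_bigl => i.
      by apply/asboolP/asboolP => [[]|].
    by rewrite big1// => i /asboolP[].
Qed.

(** * Finite covers of a cell *)

Lemma pigeonhole (I : finType) (P : 'I_#|I|.+1 -> I -> Prop) :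
  (forall k, exists i, P k i) ->
  exists i (k l : 'I_#|I|.+1), [/\ k != l, P k i & P l i].
Proof.
move=> /choice[f Pf]; have : ~~ injectiveb f.
  by apply/negP => /injectiveP/leq_card; rewrite card_ord ltnn.
case/injectivePn => k [l kl fkl]; exists (f k), k, l; split => //.
by rewrite fkl.
Qed.

Lemma submx_sub (F : fieldType) m1 m2 n (A B : 'M[F]_(m1, n)) (C : 'M[F]_(m2, n)) :
  (A <= C)%MS -> (B <= C)%MS -> (A - B <= C)%MS.
Proof. by move=> AC BC; rewrite addmx_sub ?eqmx_opp. Qed.

(** The ground field is infinite: two points [w + k u] in the same subspace would put both [u] and
    [w] into it, so finitely many subspaces cannot block all [k]. *)
Lemma avoid_subspaces (F : numFieldType) m (I : finType) (W : 'M[F]_m)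
    (W' : I -> 'M[F]_m) : (forall i, ~~ (W <= W' i)%MS) ->
  exists2 w : 'rV_m, (w <= W)%MS & forall i, ~~ (w <= W' i)%MS.
Proof.
move=> notsub; suff [w wW hw] : exists2 w : 'rV_m, (w <= W)%MS &
    forall i, i \in enum I -> ~~ (w <= W' i)%MS.
  by exists w => // i; apply: hw; rewrite mem_enum.
elim: (enum I) => [|i s [w wW hw]]; first by exists 0; rewrite ?sub0mx.
have [wi|wi] := boolP (w <= W' i)%MS; last first.
  by exists w => // j; rewrite inE => /orP[/eqP->//|/hw].
have /row_subPn[r ri] := notsub i; set u := row r W in ri.
have uW : (u <= W)%MS by exact: row_sub.
(* The coefficients start at 1 because [w] itself lies in [W' i] while [u] does not, so that a
   nonzero multiple of [u] leads out of [W' i]. *)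
have [//|/existsNP[k hk]] := pselect (forall k : 'I_#|I|.+1,
    exists j, j \in s /\ ((w + k.+1%:R *: u)%R <= W' j)%MS).
  case/pigeonhole => j [k [l [kl [js wk] [_ wl]]]].
  have kl0 : k.+1%:R - l.+1%:R != 0 :> F.
    by rewrite subr_eq0 eqr_nat eqSS.
  have uj : (u <= W' j)%MS.
    have : ((k.+1%:R - l.+1%:R) *: u <= W' j)%MS.
      have -> : (k.+1%:R - l.+1%:R) *: u =
          (w + k.+1%:R *: u) - (w + l.+1%:R *: u).
        by rewrite opprD addrACA subrr add0r scalerBl.
      exact: submx_sub.
    by rewrite eqmx_scale.
  case/negP: (hw j js); have -> : w = (w + k.+1%:R *: u) - k.+1%:R *: u by rewrite addrK.
  by rewrite submx_sub ?scalemx_sub.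
exists (w + k.+1%:R *: u); first by rewrite addmx_sub// scalemx_sub.
move=> j; rewrite inE => /orP[/eqP->|js]; last by apply/negP => ?; apply: hk; exists j.
apply: contra ri => h; have : (k.+1%:R *: u <= W' i)%MS.
  have -> : k.+1%:R *: u = (w + k.+1%:R *: u) - w by rewrite addrAC subrr add0r.
  exact: submx_sub.
by rewrite eqmx_scale// pnatr_eq0.
Qed.

(** If all nonempty pieces had smaller rank, some direction of [W] would lie in none of their
    direction spaces; but among enough points on a short segment in that direction two fall into one
    piece, whose directions then contain it. *)
Lemma cell_cover_rank (R : realType) m (I : finType) (W : 'M[R]_m)
    (C : set 'rV[R]_m) (W' : I -> 'M[R]_m) (C' : I -> set 'rV[R]_m) :
  cell W C -> C !=set0 ->
  (forall i x y, C' i x -> C' i y -> (y - x <= W' i)%MS) ->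
  (forall x, C x -> exists i, C' i x) ->
  exists2 i, C' i !=set0 & (\rank W <= \rank (W' i))%N.
Proof.
move=> cC [x Cx] dir cover; apply: contrapT => small.
have notsub i : C' i !=set0 -> ~~ (W <= W' i)%MS.
  by move=> Ci; apply/negP => /mxrankS r; apply: small; exists i.
(* An empty piece puts no constraint on [W' i], which could be the whole space; it is replaced by
   0. *)
pose W0 i := if `[< C' i !=set0 >] then W' i else 0.
have [|w wW hw] := @avoid_subspaces R m I W W0.
  move=> i; rewrite /W0; case: asboolP => [/notsub//|_].
  rewrite submx0 -mxrank_eq0; apply/eqP => r0.
  by have [j Cj] := cover x Cx; apply: small; exists j; [exists x|rewrite r0].
have [e e0 he] := cell_segment cC Cx wW.
have pt (k : 'I_#|I|.+1) : exists i, C' i (x + (e / k.+1%:R) *: w).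
  apply: cover; apply: he; rewrite divr_ge0 ?(ltW e0)//=.
  by rewrite ler_pdivrMr// ler_peMr ?(ltW e0)// ler1n.
have [i [k [l [kl Ck Cl]]]] := pigeonhole pt.
have kl0 : e / l.+1%:R - e / k.+1%:R != 0.
  rewrite -mulrBr mulf_eq0 gt_eqF//= subr_eq0 (inj_eq invr_inj) eqr_nat eqSS.
  by rewrite eq_sym.
case/negP: (hw i); rewrite /W0 asboolT; last by eexists; exact: Ck.
have := dir _ _ _ Ck Cl; rewrite opprD addrACA subrr add0r -scalerBl.
by rewrite eqmx_scale.
Qed.

Lemma cell_bigcap (R : realType) m (I : finType) (P : pred I)
    (W : I -> 'M[R]_m) (C : I -> set 'rV[R]_m) :
  (forall i, cell (W i) (C i)) ->
  cell (\bigcap_(i | P i) W i)%MS [set x | forall i, P i -> C i x].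
Proof.
move=> cC.
have -> : [set x | forall i, P i -> C i x] =
    [set x | forall i, i \in index_enum I -> P i -> C i x].
  apply/seteqP; split => x /= h i; last by apply: h; rewrite mem_index_enum.
  by move=> _; exact: h.
elim: (index_enum I) => [|i s IH].
  rewrite big_nil; have := @cellT R m; congr (cell _ _).
  by apply/seteqP; split.
rewrite big_cons; case: ifP => Pi.
  have := cellI (cC i) IH; congr (cell _ _); apply/seteqP; split => x /=.
    by move=> [Cx h] j; rewrite inE => /orP[/eqP->//|]; exact: h.
  move=> h; split; first by apply: h; rewrite ?mem_head.
  by move=> j js; apply: h; rewrite inE js orbT.
congr (cell _ _): IH; apply/seteqP; split => x /= h j.
  by rewrite inE => /orP[/eqP->|]; [rewrite Pi|exact: h].
by move=> js; apply: h; rewrite inE js orbT.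
Qed.

(** * Open simplices *)

Section OpenSimplex.
Variables (R : realType) (V : finType).
Implicit Types (s : {set V}) (x y w : 'rV[R]_#|V|).

Lemma eq_bary x y : (forall v : V, x ord0 (enum_rank v) = y ord0 (enum_rank v)) -> x = y.
Proof. by move=> h; apply/rowP => j; rewrite -(enum_valK j). Qed.

Lemma sum_bary x : \sum_v x ord0 (enum_rank v) = \sum_j x ord0 j.
Proof.
rewrite (reindex (@enum_rank V)) //.
by exists enum_val => j _; rewrite ?enum_rankK ?enum_valK.
Qed.

Definition open_simplex s : set 'rV[R]_#|V| :=
  [set x | [/\ forall v, v \in s -> 0 < x ord0 (enum_rank v),
    forall v, v \notin s -> x ord0 (enum_rank v) = 0
    & \sum_v x ord0 (enum_rank v) = 1]].

Definition face_mx s : 'M[R]_(#|s|, #|V|) :=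
  \matrix_(i, j) (j == enum_rank (enum_val i))%:R.

(** The directions of the affine hull: vectors supported on [s] with coordinate sum zero. The rows
    of [face_mx s] are the vertices of [s] as points. *)
Definition open_simplex_mx s : 'M[R]_#|V| :=
  (<<face_mx s>> :&: kermx (const_mx 1 : 'cV_#|V|))%MS.

Lemma sub_face_mx s w :
  reflect (forall v, v \notin s -> w ord0 (enum_rank v) = 0) (w <= face_mx s)%MS.
Proof.
apply: (iffP idP) => [/submxP[u ->] v vs|w0].
  rewrite mxE big1// => i _; rewrite mxE (inj_eq enum_rank_inj).
  case: eqP => [vE|]; last by rewrite mulr0.
  by case/negP: vs; rewrite vE enum_valP.
apply/submxP; exists (\row_i w ord0 (enum_rank (enum_val i))).
apply: eq_bary => v; rewrite mxE; have [vs|vs] := boolP (v \in s).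
  rewrite (bigD1 (enum_rank_in vs v))//= !mxE enum_rankK_in// eqxx mulr1.
  rewrite big1 ?addr0// => i iv; rewrite !mxE (inj_eq enum_rank_inj).
  case: eqP => [vE|]; last by rewrite mulr0.
  by case/eqP: iv; apply: enum_val_inj; rewrite enum_rankK_in.
rewrite w0// big1// => i _; rewrite !mxE (inj_eq enum_rank_inj).
case: eqP => [vE|]; last by rewrite mulr0.
by case/negP: vs; rewrite vE enum_valP.
Qed.

Lemma sub_open_simplex_mx s w :
  (w <= open_simplex_mx s)%MS <->
  (forall v, v \notin s -> w ord0 (enum_rank v) = 0) /\
  \sum_v w ord0 (enum_rank v) = 0.
Proof.
rewrite sub_capmx genmxE.
have -> : (w <= kermx (const_mx 1 : 'cV[R]_#|V|))%MS = (\sum_v w ord0 (enum_rank v) == 0).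
  rewrite sum_bary; apply/sub_kermxP/eqP => [|w0].
    move/matrixP/(_ ord0 ord0); rewrite !mxE => {2}<-.
    by apply: eq_bigr => i _; rewrite mxE mulr1.
  apply/matrixP => i j; rewrite !ord1 !mxE -[RHS]w0.
  by apply: eq_bigr => k _; rewrite mxE mulr1.
split => [/andP[/sub_face_mx ? /eqP ?]|[? ?]] //.
by apply/andP; split; [exact/sub_face_mx|exact/eqP].
Qed.

Lemma rank_open_simplex_mx s : s != finset.set0 ->
  (\rank (open_simplex_mx s)).+1 = #|s|.
Proof.
case/set0Pn => v vs.
have free : row_free (face_mx s).
  apply/row_freeP; exists (face_mx s)^T; apply/matrixP => i j.
  rewrite !mxE (bigD1 (enum_rank (enum_val i)))//= !mxE eqxx mul1r.
  rewrite (inj_eq enum_rank_inj) (inj_eq enum_val_inj) big1 ?addr0// => k ki.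
  by rewrite !mxE (negPf ki) mul0r.
have := mxrank_mul_ker <<face_mx s>>%MS (const_mx 1 : 'cV[R]_#|V|).
rewrite mxrank_gen (eqP free) => <-.
suff -> : \rank (<<face_mx s>>%MS *m (const_mx 1 : 'cV[R]_#|V|)) = 1%N by [].
apply/eqP; rewrite eqn_leq rank_leq_col lt0n mxrank_eq0.
apply/negP => /eqP/sub_kermxP; rewrite genmxE => h.
have : ((delta_mx ord0 (enum_rank v) : 'rV[R]_#|V|) <= face_mx s)%MS.
  apply/sub_face_mx => u us; rewrite mxE eqxx /= (inj_eq enum_rank_inj).
  by case: eqP us => [->|//]; rewrite vs.
move/submx_trans/(_ h)/sub_kermxP; rewrite -rowE => /matrixP/(_ ord0 ord0)/eqP.
by rewrite !mxE oner_eq0.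
Qed.

Lemma cell_open_simplex s : cell (open_simplex_mx s) (open_simplex s).
Proof.
split.
- move=> x y t [x0 xs x1] [y0 ys y1] /andP[t0 t1]; split => [v vs|v vs|].
  + have [->|tN] := eqVneq t 0.
      by rewrite scale0r add0r subr0 scale1r y0.
    rewrite !mxE ltr_pwDl ?mulr_gt0 ?x0 ?lt_def ?tN//.
    by rewrite mulr_ge0 ?subr_ge0// ltW ?y0.
  + by rewrite !mxE xs ?ys// !mulr0 addr0.
  + under eq_bigr do rewrite !mxE.
    by rewrite big_split/= -!mulr_sumr x1 y1 !mulr1 subrKC.
- move=> x y [x0 xs x1] [y0 ys y1]; apply/sub_open_simplex_mx; split => [v vs|].
    by rewrite !mxE xs ?ys// subrr.
  under eq_bigr do rewrite !mxE.
  by rewrite sumrB x1 y1 subrr.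
- move=> x w [x0 xs x1] /sub_open_simplex_mx[ws w0].
  have [|e e0 he] := @exists_common_small R V (fun v e => v \in s ->
      0 < x ord0 (enum_rank v) + e * w ord0 (enum_rank v)).
    move=> v; have [vs|vs] := boolP (v \in s); last by exists 1.
    have xv := x0 v vs; set a := x _ _ in xv *; set b := w _ _.
    have n0 : 0 < `|b| + 1 by rewrite ltr_wpDl.
    exists (a / (`|b| + 1)); first by rewrite divr_gt0.
    move=> e /andP[e0]; rewrite ler_pdivlMr// => ea _.
    have := ler_norm (- b); rewrite normrN => nb.
    have : e * - b <= e * `|b| by rewrite ler_pM2l.
    lra.
  exists e => //; split => [v vs|v vs|].
  + by rewrite !mxE he// e0 lexx.
  + by rewrite !mxE xs ?ws// mulr0 addr0.
  + under eq_bigr do rewrite !mxE.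
    by rewrite big_split/= -mulr_sumr x1 w0 mulr0 addr0.
Qed.

Lemma open_simplex_neq0 s x : open_simplex s x -> s != finset.set0.
Proof.
move=> [x0 xs x1]; apply/eqP => s0; move: x1; rewrite big1.
  by move/eqP; rewrite eq_sym oner_eq0.
by move=> v _; rewrite xs// s0 inE.
Qed.

Lemma open_simplex_support s x : open_simplex s x ->
  [set v | x ord0 (enum_rank v) != 0]%SET = s.
Proof.
move=> [x0 xs x1]; apply/setP => v; rewrite inE.
by have [vs|vs] := boolP (v \in s); [rewrite gt_eqF ?x0|rewrite xs ?eqxx].
Qed.

Lemma realizationE (K : {set {set V}}) x :
  realization R K x <->
  [set v | x ord0 (enum_rank v) != 0]%SET \in K /\
  open_simplex [set v | x ord0 (enum_rank v) != 0]%SET x.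
Proof.
split => [[x0 x1 xK]|[xK os]].
  split => //; split => // v; rewrite inE; first by rewrite lt_def x0 andbT.
  by move/negPn/eqP.
have [x0 xs x1] := os; split => // v.
have [vs|vs] := boolP (v \in [set v | x ord0 (enum_rank v) != 0]%SET).
  exact: ltW (x0 v vs).
by rewrite xs.
Qed.

Lemma open_simplex_inhabited s : s != finset.set0 -> open_simplex s !=set0.
Proof.
rewrite -card_gt0 => s0.
exists (\row_j (if enum_val j \in s then #|s|%:R^-1 else 0)); split => [v vs|v vs|].
- by rewrite mxE enum_rankK vs invr_gt0 ltr0n.
- by rewrite mxE enum_rankK (negPf vs).
- under eq_bigr do rewrite mxE enum_rankK.
  by rewrite -big_mkcond/= sumr_const -[LHS]mulr_natr mulVf// pnatr_eq0 -lt0n.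
Qed.

End OpenSimplex.

(** * Decomposition of PL graphs into cells *)

Lemma sum_subsets_expr (A : comNzRingType) (T : finType) (S : {set T}) (x : A) :
  \sum_(J : {set T} | J \subset S) x ^+ #|J| = (1 + x) ^+ #|S|.
Proof.
rewrite exprDn.
rewrite (partition_big (fun J : {set T} => inord #|J| : 'I_#|S|.+1) xpredT)//=.
apply: eq_bigr => k _; rewrite expr1n mul1r.
rewrite (eq_bigr (fun=> x ^+ k)); last first.
  move=> J /andP[JS /eqP <-]; rewrite inordK// ltnS; exact: subset_leq_card.
rewrite sumr_const -(cards_draws S k); congr (_ *+ _).
apply: eq_card => J; rewrite !inE; apply: andb_id2l => JS.
by rewrite -val_eqE/= inordK// ltnS subset_leq_card.
Qed.

Lemma alternating_sum_subsets (T : finType) (S : {set T}) :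
  S != finset.set0 ->
  \sum_(J : {set T} | (J != finset.set0) && (J \subset S)) (-1) ^+ #|J| = -1 :> int.
Proof.
rewrite -card_gt0 => S0; have := sum_subsets_expr S (-1 : int).
rewrite subrr expr0n gtn_eqF// (bigD1 finset.set0) ?finset.sub0set//= cards0 expr0 => /eqP.
rewrite addrC addr_eq0 => /eqP h; rewrite -[RHS]h.
by apply: eq_bigl => J; exact: andbC.
Qed.

Lemma convex_hull_convex (R : realType) m k (p : 'I_k -> 'rV[R]_m) :
  convex_set (convex_hull p).
Proof.
move=> _ _ u [t [t0 t1 ->]] [s [s0 s1 ->]] /andP[u0 u1].
exists (fun i => u * t i + (1 - u) * s i); split => [i||].
- by rewrite addr_ge0// mulr_ge0// subr_ge0.
- by rewrite big_split/= -!mulr_sumr t1 s1 !mulr1 subrKC.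
- rewrite !scaler_sumr -big_split/=; apply: eq_bigr => i _.
  by rewrite !scalerA -scalerDl.
Qed.

Lemma convex_hull_vertex (R : realType) m k (p : 'I_k -> 'rV[R]_m) i :
  convex_hull p (p i).
Proof.
exists (fun j => (j == i)%:R); split => [j||]; first by rewrite ler0n.
  by rewrite (bigD1 i)//= eqxx big1 ?addr0// => j /negPf ->.
by rewrite (bigD1 i)//= eqxx scale1r big1 ?addr0// => j /negPf ->; rewrite scale0r.
Qed.

Lemma affine_on_sum (R : realType) m m' (P : set 'rV[R]_m)
    (f : 'rV[R]_m -> 'rV[R]_m') k (p : 'I_k -> 'rV[R]_m) (t : 'I_k -> R) :
  convex_set P -> affine_on P f -> (forall i, P (p i)) ->
  (forall i, 0 <= t i) -> \sum_i t i = 1 ->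
  P (\sum_i t i *: p i) /\ f (\sum_i t i *: p i) = \sum_i t i *: f (p i).
Proof.
move=> cP af; elim: k p t => [|k IH] p t Pp t0.
  by rewrite big_ord0 => /eqP; rewrite eq_sym oner_eq0.
rewrite !big_ord_recl => t1; set a := t ord0 in t1 *.
have sE : \sum_(i < k) t (lift ord0 i) = 1 - a by rewrite -t1 addrAC subrr add0r.
have [a1|a1] := eqVneq a 1.
  have tl i : t (lift ord0 i) = 0.
    have /eqP := sE; rewrite a1 subrr psumr_eq0// => /allP/(_ i).
    by rewrite mem_index_enum => /(_ isT)/eqP.
  rewrite !big1 ?addr0 ?a1 ?scale1r//; first by move=> i _; rewrite tl scale0r.
  by move=> i _; rewrite tl scale0r.
have a_le1 : a <= 1 by rewrite -subr_ge0 -sE sumr_ge0.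
have a_lt1 : 0 < 1 - a by rewrite subr_gt0 lt_neqAle a1.
have [|||Ps fs] := IH (p \o lift ord0) (fun i => t (lift ord0 i) / (1 - a)).
- by move=> i; exact: Pp.
- by move=> i; rewrite divr_ge0// ltW.
- by rewrite -mulr_suml sE divff// gt_eqF.
have scE (W : lmodType R) (h : 'I_k -> W) : \sum_i t (lift ord0 i) *: h i =
    (1 - a) *: \sum_i (t (lift ord0 i) / (1 - a)) *: h i.
  rewrite scaler_sumr; apply: eq_bigr => i _.
  by rewrite scalerA mulrC divfK// gt_eqF.
rewrite !scE; have a01 : 0 <= a <= 1 by rewrite t0.
by split; [exact: cP|rewrite af// fs].
Qed.

(** The cells may overlap; inclusion and exclusion accounts for this. *)
Definition cellular (R : realType) m (Q : set 'rV[R]_m) : Prop :=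
  exists (I : finType) (V : I -> 'M[R]_m) (D : I -> set 'rV[R]_m),
    (forall i, cell (V i) (D i)) /\ Q = [set x | exists i, D i x].

(** The hull is a linear image of the standard simplex on ['I_k], and the images of its open faces
    are cells even where the linear map is not injective. *)
Lemma cellular_hull (R : realType) m k (p : 'I_k -> 'rV[R]_m) :
  cellular (convex_hull p).
Proof.
pose A : 'M[R]_(#|'I_k|, m) := \matrix_(j, l) p (enum_val j) ord0 l.
have mulA (x : 'rV_#|'I_k|) : x *m A = \sum_i x ord0 (enum_rank i) *: p i.
  apply/rowP => l; rewrite mxE summxE (reindex (@enum_rank 'I_k)) /=; last first.
    by exists enum_val => j _; rewrite ?enum_rankK ?enum_valK.
  by apply: eq_bigr => i _; rewrite !mxE enum_rankK.
exists {set 'I_k}, (fun s => <<open_simplex_mx R s *m A>>%MS).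
exists (fun s => [set x *m A | x in open_simplex s]); split.
  by move=> s; apply: cell_image; exact: cell_open_simplex.
apply/seteqP; split => x /=.
  move=> [t [t0 t1 xE]]; pose y : 'rV[R]_#|'I_k| := \row_j t (enum_val j).
  have yE i : y ord0 (enum_rank i) = t i by rewrite mxE enum_rankK.
  have [|_ ys] := (realizationE [set: {set 'I_k}]%SET y).1.
    split => [v||]; first by rewrite yE.
      by under eq_bigr do rewrite yE.
    by rewrite inE.
  exists [set v | y ord0 (enum_rank v) != 0]%SET, y => //.
  by rewrite mulA xE; apply: eq_bigr => i _; rewrite yE.
move=> [s [y [y0 ys y1] <-]]; exists (fun i => y ord0 (enum_rank i)); split => //.
move=> i; have [/y0/ltW//|/ys->//] := boolP (i \in s).
Qed.

Lemma cellular_bigcup (R : realType) m k (P : 'I_k -> set 'rV[R]_m) :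
  (forall i, cellular (P i)) -> cellular (\bigcup_i P i).
Proof.
move=> cP.
pose T := {I : finType & ((I -> 'M[R]_m) * (I -> set 'rV[R]_m))%type}.
have /choice[F FE] : forall i, exists X : T,
    (forall j, cell ((projT2 X).1 j) ((projT2 X).2 j)) /\
    P i = [set x | exists j, (projT2 X).2 j x].
  by move=> i; have [I [V [D [cD PE]]]] := cP i; exists (existT _ I (V, D)).
exists {i : 'I_k & projT1 (F i)}.
exists (fun j => (projT2 (F (tag j))).1 (tagged j)).
exists (fun j => (projT2 (F (tag j))).2 (tagged j)); split.
  by move=> [i j] /=; exact: (FE i).1.
apply/seteqP; split => x /=.
  move=> [i _]; rewrite (FE i).2 => -[j xj].
  by exists (Tagged (fun i => projT1 (F i)) j).
move=> [[i j] xj]; exists i => //; rewrite (FE i).2; by exists j.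
Qed.

Lemma sum_scale_row_mx (R : realType) m m' k (t : 'I_k -> R)
    (a : 'I_k -> 'rV[R]_m) (b : 'I_k -> 'rV[R]_m') :
  \sum_i t i *: row_mx (a i) (b i) = row_mx (\sum_i t i *: a i) (\sum_i t i *: b i).
Proof.
apply/rowP => c; rewrite summxE -[c](splitK) /=.
case: (fintype.split c) => c'; rewrite /= ?row_mxEl ?row_mxEr summxE;
  by apply: eq_bigr => j _; rewrite [LHS]mxE [RHS]mxE ?row_mxEl ?row_mxEr.
Qed.

(** Over a polytope where [f] is affine, the graph is the convex hull of its points over the
    vertices. *)
Lemma PL_graph_cellular (R : realType) m m' (A : set 'rV[R]_m)
    (f : 'rV[R]_m -> 'rV[R]_m') :
  PL_on A f -> cellular [set row_mx x (f x) | x in A].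
Proof.
move=> [_ [k [P [-> hP]]]].
have -> : [set row_mx x (f x) | x in \bigcup_i P i] =
    \bigcup_i [set row_mx x (f x) | x in P i] by rewrite image_bigcup.
apply: cellular_bigcup => i; have [[l [p PE]] af] := hP i.
have -> : [set row_mx x (f x) | x in P i] =
    convex_hull (fun j => row_mx (p j) (f (p j))); last exact: cellular_hull.
have sumE (t : 'I_l -> R) : (forall j, 0 <= t j) -> \sum_j t j = 1 ->
    \sum_j t j *: row_mx (p j) (f (p j)) =
    row_mx (\sum_j t j *: p j) (f (\sum_j t j *: p j)).
  move=> t0 t1; have cP : convex_set (P i) by rewrite PE; exact: convex_hull_convex.
  have pP j : P i (p j) by rewrite PE; exact: convex_hull_vertex.
  by have [_ ->] := affine_on_sum cP af pP t0 t1; exact: sum_scale_row_mx.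
apply/seteqP; split => [_ [x Px <-]|y].
  have [t [t0 t1 ->]] : convex_hull p x by rewrite -PE.
  by exists t; split => //; rewrite sumE.
move=> [t [t0 t1 ->]]; rewrite sumE//; exists (\sum_j t j *: p j) => //.
by rewrite PE; exists t.
Qed.

Lemma within_continuous_coord (R : realType) m m' (A : set 'rV[R]_m)
    (f : 'rV[R]_m -> 'rV[R]_m') (x : 'rV[R]_m) (e : R) :
  {within A, continuous f} -> A x -> 0 < e ->
  exists2 d, 0 < d & forall y, A y ->
    (forall j, `|y ord0 j - x ord0 j| < d) ->
    forall j, `|f y ord0 j - f x ord0 j| < e.
Proof.
move=> /subspace_continuousP cf Ax e0.
have /cf/(_ (ball (f x) e)) := Ax.
move=> /(_ (nbhsx_ballx _ _ e0)) /nbhs_ballP[d /= d0 hd].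
exists d => // y Ay hy j.
have bxy : ball x d y by split => // i k; rewrite ord1 /= -ball_normE/= distrC.
have [_ /(_ ord0 j)] := hd _ bxy Ay.
by rewrite -ball_normE/= distrC.
Qed.

Lemma cell_set0 (R : realType) m (W : 'M[R]_m) : cell W set0.
Proof. by split. Qed.

Definition hits (R : realType) (V : finType) (U : set 'rV[R]_#|V|) (s : {set V}) : bool :=
  `[< open_simplex s `&` U !=set0 >].

(** At each point of the realization inside [U], the signed sum over the nonempty [J] whose
    intersection projects onto the point is -1 by inclusion and exclusion, and exactly one open
    simplex contributes 1. The valuation turns this into the equality. Its left-hand side involves
    [A] and [U] only through the sets [J] that survive, so two projections of one graph can be
    compared. *)
Lemma euler_projection (R : realType) p (I : finType) (V : I -> 'M[R]_p)
    (D : I -> set 'rV[R]_p) (W : finType) (K : {set {set W}})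
    (A : 'M[R]_(p, #|W|)) (U : set 'rV[R]_#|W|) :
  (forall i, cell (V i) (D i)) ->
  (forall i j x y, D i x -> D j y -> x *m A = y *m A -> x = y) ->
  (forall y, realization R K y <-> exists i x, D i x /\ x *m A = y) ->
  cell 1%:M U ->
  \sum_(J : {set I} | (J != finset.set0) &&
       `[< exists x, (forall i, i \in J -> D i x) /\ U (x *m A) >])
     (-1) ^+ \rank (\bigcap_(i in J) V i)%MS * (-1) ^+ #|J| =
  \sum_(s in K | hits U s) (-1) ^+ #|s| :> int.
Proof.
move=> cD inj im cU.
pose DJ (J : {set I}) := [set x | forall i, i \in J -> D i x].
pose VJ (J : {set I}) := (\bigcap_(i in J) V i)%MS.
(* The excluded indices, [J] empty and [s] outside [K], receive the empty set, so that one family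
   over a full finite type results. *)
pose C (j : {set I} + {set W}) : set 'rV[R]_#|W| := match j with
  | inl J => if J == finset.set0 then set0 else [set x *m A | x in DJ J] `&` U
  | inr s => if s \in K then open_simplex s `&` U else set0 end.
pose Wj (j : {set I} + {set W}) : 'M[R]_#|W| := match j with
  | inl J => (<<VJ J *m A>> :&: 1%:M)%MS
  | inr s => (open_simplex_mx R s :&: 1%:M)%MS end.
pose c (j : {set I} + {set W}) : int := match j with
  | inl J => (-1) ^+ #|J| | inr s => 1 end.
have cDJ J : cell (VJ J) (DJ J) by exact: cell_bigcap.
have cC j : cell (Wj j) (C j).
  case: j => [J|s] /=; case: ifP => _; try exact: cell_set0; apply: cellI => //.
    exact: cell_image.
  exact: cell_open_simplex.
have bnd j x k : C j x -> - 0 <= x ord0 k.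
  rewrite oppr0; case: j => [J|s] /=; case: ifP => // JK.
    case=> -[y Dy <-] _; have /set0Pn[i iJ] := negbT JK.
    have [] : realization R K (y *m A) by apply/im; exists i, y; split => //; exact: Dy.
    by move=> h _ _; rewrite -(enum_valK k); exact: h.
  move=> [[x0 xs _] _]; rewrite -(enum_valK k).
  by have [/x0/ltW|/xs->] := boolP (enum_val k \in s).
have sum0 x : \sum_(j | `[< C j x >]) c j = 0.
  rewrite big_mkcond big_sumType /=.
  have [[Ux Kx]|nUK] := pselect (U x /\ realization R K x); last first.
    rewrite !big1 ?addr0// => [s _|J _]; rewrite asboolF//; case: ifP => h.
    - move=> [xs Ux]; apply: nUK; split => //; apply/realizationE.
      by rewrite (open_simplex_support xs).
    - by [].
    - by [].
    - case=> -[y Dy xE] Ux; apply: nUK; split => //; apply/im.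
      by have /set0Pn[i iJ] := negbT h; exists i, y; split => //; exact: Dy.
  have [i [y [Diy yx]]] := (im x).1 Kx.
  (* By injectivity of the projection the point has one preimage [y]; [S] collects the cells through
     it. *)
  pose S := [set j | `[< D j y >]]%SET.
  have S0 : S != finset.set0 by apply/set0Pn; exists i; rewrite inE; apply/asboolP.
  have -> : \sum_J (if `[< C (inl J) x >] then (-1) ^+ #|J| else 0) = -1 :> int.
    rewrite -(alternating_sum_subsets S0) [RHS]big_mkcond; apply: eq_bigr => J _ /=.
    case: eqVneq => /= [_|J0]; first by rewrite asboolF.
    congr (if _ then _ else _); apply/asboolP/fintype.subsetP.
      move=> [[z Dz zx] _] j jJ; rewrite inE; apply/asboolP.
      suff -> : y = z by exact: Dz.
      by apply: (inj i j) => //; [exact: Dz|rewrite zx].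
    move=> JS; split => //; exists y => // j /JS.
    by rewrite inE => /asboolP.
  have /realizationE[tK xt] := Kx; set t := [set v | _]%SET in tK xt.
  rewrite (bigD1 t)//= tK asboolT// big1 ?addr0 ?addNr// => s st.
  rewrite asboolF//; case: ifP => _ []// /open_simplex_support tE _.
  by case/eqP: st; rewrite -tE.
have := euler_cells cC bnd sum0; rewrite big_mkcond big_sumType /= => /eqP.
rewrite addr_eq0 => /eqP; rewrite -!big_mkcond /= => h.
have -> : \sum_(J : {set I} | (J != finset.set0) &&
       `[< exists x, (forall i, i \in J -> D i x) /\ U (x *m A) >])
     (-1) ^+ \rank (\bigcap_(i in J) V i)%MS * (-1) ^+ #|J| =
   \sum_(J | `[< C (inl J) !=set0 >]) (-1) ^+ \rank (Wj (inl J)) * (-1) ^+ #|J| :> int.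
  apply: eq_big => [J|J /andP[J0 /asboolP[x [Dx Ux]]]] /=.
    case: eqVneq => J0 /=; first by rewrite asboolF// => -[].
    apply/asboolP/asboolP => [[x [Dx Ux]]|[_ [[x Dx <-] Ux]]].
      by exists (x *m A); split => //; exists x.
    by exists x.
  rewrite rank_capmx1 (rank_cell_image (cDJ J))//; first by exists x.
  have /set0Pn[i iJ] := J0.
  by move=> y z; rewrite !inE => Dy Dz; apply: (inj i i); [exact: Dy|exact: Dz].
rewrite h -sumrN; apply: eq_big => [s|s /asboolP[x]] /=.
  by rewrite /hits; case: ifP => // _; rewrite asboolF// => -[].
case: ifP => [sK [xs _]|_ []//].
(* The dimension is one less than [#|s|], which absorbs the sign from moving this sum to the other
   side. *)
by rewrite rank_capmx1 -(rank_open_simplex_mx R (open_simplex_neq0 xs)) exprS mulN1r mulr1.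
Qed.

(** * PL invariance of Euler characteristics and of dimension *)

Lemma cell_preimage (R : realType) m p (W : 'M[R]_p) (C : set 'rV[R]_p)
    (A : 'M[R]_(m, p)) : cell W C ->
  cell (kermx (A *m cokermx W)) [set x : 'rV_m | C (x *m A)].
Proof.
have kerE (w : 'rV_m) : (w <= kermx (A *m cokermx W))%MS = (w *m A <= W)%MS.
  by rewrite [RHS]submxE sub_kermx mulmxA.
move=> [cvx dir opn]; split => [x y t /= Cx Cy t01|x y /= Cx Cy|x w /= Cx].
- by rewrite mulmxDl -!scalemxAl; exact: cvx.
- by rewrite kerE mulmxBl dir.
- rewrite kerE => wW; have [e e0 Ce] := opn _ _ Cx wW.
  by exists e => //; rewrite mulmxDl -scalemxAl.
Qed.

Section PLInvariance.
Variables (R : realType) (V V' : finType) (K : {set {set V}}) (K' : {set {set V'}}).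
Variables (f : 'rV[R]_#|V| -> 'rV[R]_#|V'|) (g : 'rV[R]_#|V'| -> 'rV[R]_#|V|).
Hypothesis fg : mutually_inverse (realization R K) (realization R K') f g.
Hypothesis fPL : PL_on (realization R K) f.

Let A1 : 'M[R]_(#|V| + #|V'|, #|V|) := col_mx 1%:M 0.
Let A2 : 'M[R]_(#|V| + #|V'|, #|V'|) := col_mx 0 1%:M.

Let mulA1 (x : 'rV[R]_#|V|) (y : 'rV[R]_#|V'|) : row_mx x y *m A1 = x.
Proof. by rewrite mul_row_col mulmx1 mulmx0 addr0. Qed.

Let mulA2 (x : 'rV[R]_#|V|) (y : 'rV[R]_#|V'|) : row_mx x y *m A2 = y.
Proof. by rewrite mul_row_col mulmx1 mulmx0 add0r. Qed.

Let fK x : realization R K x -> realization R K' (f x).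
Proof. by case: fg => h _ _ _; exact: h. Qed.

Let f_inj x y : realization R K x -> realization R K y -> f x = f y -> x = y.
Proof. by case: fg => _ _ gf _ Kx Ky fE; rewrite -(gf x)// -(gf y)// fE. Qed.

(** Both sums are the same count on the graph, projected once to the source and once to the target.
    The pieces [E] are fixed before [U] and [U'], since the boxes inserted later are chosen small in
    terms of [E]. *)
Lemma PL_homeomorphic_count :
  exists (I : finType) (E : I -> set 'rV[R]_#|V|), forall U U',
    cell 1%:M U -> cell 1%:M U' ->
    (forall J : {set I},
      (exists x, [/\ realization R K x, forall i, i \in J -> E i x & U x]) <->
      (exists x, [/\ realization R K x, forall i, i \in J -> E i x & U' (f x)])) ->
    \sum_(s in K | hits U s) (-1) ^+ #|s| =
    \sum_(s in K' | hits U' s) (-1) ^+ #|s| :> int.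
Proof.
have [I [W [D [cD /seteqP[GD DG]]]]] := PL_graph_cellular fPL.
exists I, (fun i => [set x | D i (row_mx x (f x))]) => U U' cU cU' UU'.
have {}DG i z : D i z -> exists2 x, realization R K x & z = row_mx x (f x).
  by move=> Dz; have [|x Kx <-] := DG z; [exists i|exists x].
have {}GD x : realization R K x -> exists i, D i (row_mx x (f x)).
  by move=> Kx; have [|i] := GD (row_mx x (f x)); [exists x|exists i].
rewrite -(@euler_projection R _ I W D V K A1 U)//; first last.
- move=> x; split => [/GD[i Di]|[i [z [/DG[y Ky ->] <-]]]]; last by rewrite mulA1.
  by exists i; exists (row_mx x (f x)); rewrite mulA1.
- by move=> i j _ _ /DG[x Kx ->] /DG[y Ky ->]; rewrite !mulA1 => ->.
rewrite -(@euler_projection R _ I W D V' K' A2 U')//; first last.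
- move=> y; split => [K'y|[i [z [/DG[x Kx ->] <-]]]]; last by rewrite mulA2; exact: fK.
  have [_ gK _ fgK] := fg; have [i Di] := GD _ (gK _ K'y).
  by exists i; exists (row_mx (g y) (f (g y))); split => //; rewrite mulA2 fgK.
- by move=> i j _ _ /DG[x Kx ->] /DG[y Ky ->]; rewrite !mulA2 => /(f_inj Kx Ky) ->.
apply: eq_bigl => J; case: eqVneq => //= J0; have /set0Pn[i0 i0J] := J0.
apply/asboolP/asboolP => -[z [Dz]]; have [x Kx zE] := DG _ _ (Dz _ i0J);
    move: Dz; rewrite zE ?mulA1 ?mulA2 => Dz Ux.
  have [|y [Ky Ey Uy]] := (UU' J).1; first by exists x.
  by exists (row_mx y (f y)); rewrite mulA2.
have [|y [Ky Ey Uy]] := (UU' J).2; first by exists x.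
by exists (row_mx y (f y)); rewrite mulA1.
Qed.

Lemma PL_homeomorphic_euler :
  simplicial_complex K -> simplicial_complex K' ->
  \sum_(s in K) (-1) ^+ #|s| = \sum_(s in K') (-1) ^+ #|s| :> int.
Proof.
move=> [K0 _] [K'0 _]; have [I [E cnt]] := PL_homeomorphic_count.
have := cnt setT setT (cellT _ _) (cellT _ _).
have hitsT (W : finType) (L : {set {set W}}) : finset.set0 \notin L ->
    \sum_(s in L | hits (R := R) setT s) (-1) ^+ #|s| =
    \sum_(s in L) (-1) ^+ #|s| :> int.
  move=> L0; apply: eq_bigl => s; apply: andb_idr => sL.
  apply/asboolP; rewrite setIT; apply: open_simplex_inhabited.
  by apply: contraNneq L0 => <-.
by rewrite !hitsT//; apply => J; split.
Qed.

(** The parts of graph cells that lie over the open simplex [s] and over an open simplex of [K']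
    project onto a cover of [s]. One of them has full rank, and the other projection, injective as
    well, carries it into a single open simplex of [K']. *)
Lemma PL_homeomorphic_dim s : finset.set0 \notin K -> s \in K ->
  exists2 s', s' \in K' & (#|s| <= #|s'|)%N.
Proof.
move=> K0 sK; have s0 : s != finset.set0 by apply: contraNneq K0 => <-.
have [I [W [D [cD /seteqP[GD DG]]]]] := PL_graph_cellular fPL.
pose Z (j : I * {set V'}) := D j.1 `&` ([set z | open_simplex s (z *m A1)] `&`
  [set z | open_simplex j.2 (z *m A2)]).
pose WZ (j : I * {set V'}) := (W j.1 :&: (kermx (A1 *m cokermx (open_simplex_mx R s)) :&:
  kermx (A2 *m cokermx (open_simplex_mx R j.2))))%MS.
have cZ j : cell (WZ j) (Z j).
  by apply: cellI => //; apply: cellI; apply: cell_preimage; exact: cell_open_simplex.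
have cZ1 j := cell_image A1 (cZ j).
have [j x y|x xs|[i t] [_ [z zZ _]]] := @cell_cover_rank R _ _ _ _
   (fun j => <<WZ j *m A1>>%MS) (fun j => [set z *m A1 | z in Z j])
   (cell_open_simplex R s) (open_simplex_inhabited R s0).
- by have [_ dir _] := cZ1 j; exact: dir.
- have Kx : realization R K x by apply/realizationE; rewrite (open_simplex_support xs).
  have [|i Di] := GD (row_mx x (f x)); first by exists x.
  have /realizationE[_ ft] := fK Kx.
  exists (i, [set v | f x ord0 (enum_rank v) != 0]%SET).
  exists (row_mx x (f x)); last by rewrite mulA1.
  by split => //; split; rewrite /= ?mulA1 ?mulA2.
have Zgraph z' : Z (i, t) z' -> exists2 x, realization R K x & z' = row_mx x (f x).
  move=> [Dz' _]; have [|x Kx <-] := DG z'; first by exists i.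
  by exists x.
have [x Kx zE] := Zgraph z zZ; have [_ [_ /= tz]] := zZ.
rewrite zE mulA2 in tz; have /realizationE[] := fK Kx.
rewrite (open_simplex_support tz) => tK' _ rk; exists t => //.
rewrite -(rank_open_simplex_mx R s0) -(rank_open_simplex_mx R (open_simplex_neq0 tz)).
rewrite ltnS; apply: leq_trans rk _.
have Zn : Z (i, t) !=set0 by exists z.
rewrite (rank_cell_image (cZ (i, t)))//; last first.
  move=> a b; rewrite !inE => /Zgraph[x1 K1 ->] /Zgraph[x2 K2 ->].
  by rewrite !mulA1 => ->.
rewrite -(rank_cell_image (A := A2) (cZ (i, t)) Zn); last first.
  move=> a b; rewrite !inE => /Zgraph[x1 K1 ->] /Zgraph[x2 K2 ->].
  by rewrite !mulA2 => /(f_inj K1 K2) ->.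
apply: mxrankS; rewrite genmxE; apply/row_subP => r; rewrite row_mul.
rewrite submxE -mulmxA -sub_kermx; apply: submx_trans (row_sub _ _) _.
exact: submx_trans (capmxSr _ _) (capmxSr _ _).
Qed.

End PLInvariance.

(** * Euler sums near a point *)

Definition box (R : realType) m (x : 'rV[R]_m) (d : R) : set 'rV[R]_m :=
  [set y | forall j, `|y ord0 j - x ord0 j| < d].

(** Meeting a box is monotone in its size, so for small boxes it means that [x] lies in the closure
    of the image of [Q] under [h]; unlike boxes, this is a condition that homeomorphisms
    preserve. *)
Lemma box_eventually (R : realType) m (x : 'rV[R]_m) (T : Type)
    (Q : set T) (h : T -> 'rV[R]_m) :
  exists2 e, 0 < e & forall d, 0 < d <= e ->
    (exists y, Q y /\ box x d (h y)) <->
    (forall r, 0 < r -> exists y, Q y /\ box x r (h y)).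
Proof.
have [near|/existsNP[e /not_implyP[e0 far]]] :=
    pselect (forall r, 0 < r -> exists y, Q y /\ box x r (h y)).
  by exists 1 => // d /andP[d0 _]; split => // _; exact: near.
exists e => // d /andP[d0 de]; split => [[y [Qy hy]]|/(_ d d0)//].
by case: far; exists y; split => // j; apply: lt_le_trans de.
Qed.

(** In a small box the coordinates at the vertices of [t] stay positive. Conversely, if [t] is a
    face of [s], a slight push from [x] towards a point of the open simplex [s] enters it. *)
Lemma box_open_simplex (R : realType) (V : finType) (t : {set V}) (x : 'rV[R]_#|V|) :
  open_simplex t x -> exists2 e, 0 < e & forall d, 0 < d <= e ->
    forall s, hits (box x d) s = (t \subset s).
Proof.
move=> xt; have [x0 xs x1] := xt.
have [|e e0 he] := @exists_common_small R V (fun v d => v \in t -> d <= x ord0 (enum_rank v)).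
  move=> v; have [vt|vt] := boolP (v \in t); last by exists 1.
  by exists (x ord0 (enum_rank v)); [exact: x0|move=> d /andP[]].
exists e => // d de s; have /andP[d0 _] := de.
apply/asboolP/fintype.subsetP => [[y [[y0 ys y1] hy]] v vt|ts].
  apply: contrapT => /negP /ys yv; have := hy (enum_rank v).
  rewrite yv sub0r normrN gtr0_norm ?x0// => xd.
  by have := he v d de vt; rewrite leNgt xd.
have s0 : s != finset.set0.
  have /set0Pn[v vt] := open_simplex_neq0 xt; apply/set0Pn; exists v; exact: ts.
have [b [b0 bs b1]] := open_simplex_inhabited R s0.
(* Barycentric coordinates differ by at most 1, so [d / 2] keeps the push inside the box; [2^-1]
   keeps the combination convex. *)
pose u := Num.min (2^-1) (d / 2).
have u0 : 0 < u by rewrite lt_min invr_gt0 ltr0n divr_gt0.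
have u1 : u <= 2^-1 by rewrite ge_min lexx.
have ud : u <= d / 2 by rewrite ge_min lexx orbT.
have in01 (z : 'rV[R]_#|V|) : (forall v, 0 <= z ord0 (enum_rank v)) ->
    \sum_v z ord0 (enum_rank v) = 1 -> forall v, z ord0 (enum_rank v) <= 1.
  by move=> z0 z1 v; rewrite -z1 (bigD1 v)//= lerDl sumr_ge0.
have xn v : 0 <= x ord0 (enum_rank v).
  by have [/x0/ltW|/xs->] := boolP (v \in t).
have bn v : 0 <= b ord0 (enum_rank v).
  by have [/b0/ltW|/bs->] := boolP (v \in s).
exists (u *: b + (1 - u) *: x); split; first split => [v vs|v vs|].
- rewrite !mxE; have := b0 v vs; have := xn v; set p := x _ _; set q := b _ _ => hp hq.
  have h1 : 0 < u * q by rewrite mulr_gt0.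
  have h2 : 0 <= (1 - u) * p by rewrite mulr_ge0//; lra.
  lra.
- rewrite !mxE bs// xs ?mulr0 ?addr0//; apply: contra vs; exact: ts.
- under eq_bigr do rewrite !mxE.
  by rewrite big_split/= -!mulr_sumr b1 x1 !mulr1 subrKC.
- move=> j; rewrite -(enum_valK j); set v := enum_val j; rewrite !mxE.
  have := in01 x xn x1 v; have := in01 b bn b1 v; have := xn v; have := bn v.
  set p := x _ _; set q := b _ _ => q0 p0 q1 p1.
  have -> : u * q + (1 - u) * p - p = u * (q - p) by ring.
  rewrite normrM gtr0_norm//.
  have h : `|q - p| <= 1 by rewrite ler_norml; lra.
  have : u * `|q - p| <= u * 1 by rewrite ler_pM2l.
  lra.
Qed.

Lemma PL_homeomorphic_local_euler (R : realType) (V V' : finType)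
    (K : {set {set V}}) (K' : {set {set V'}})
    (f : 'rV[R]_#|V| -> 'rV[R]_#|V'|) (g : 'rV[R]_#|V'| -> 'rV[R]_#|V|)
    (t : {set V}) (t' : {set V'}) (x : 'rV[R]_#|V|) :
  mutually_inverse (realization R K) (realization R K') f g ->
  PL_on (realization R K) f -> {within realization R K', continuous g} ->
  t \in K -> open_simplex t x -> open_simplex t' (f x) ->
  \sum_(s in K | t \subset s) (-1) ^+ #|s| =
  \sum_(s in K' | t' \subset s) (-1) ^+ #|s| :> int.
Proof.
move=> fg fPL gc tK xt fxt.
have [I [E cnt]] := PL_homeomorphic_count fg fPL.
have [fK gK gf fgE] := fg; have [fc _] := fPL.
have Kx : realization R K x by apply/realizationE; rewrite (open_simplex_support xt).
pose Q (J : {set I}) := [set y | realization R K y /\ forall i, i \in J -> E i y].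
have [e1 e10 h1] := box_open_simplex xt.
have [e2 e20 h2] := box_open_simplex fxt.
have [e3 e30 h3] := exists_common_small (fun J => box_eventually x (Q J) id).
have [e4 e40 h4] := exists_common_small (fun J => box_eventually (f x) (Q J) f).
(* Below all four thresholds the boxes meet exactly the simplices around [t] and [t'], and an
   intersection of pieces meets them exactly when the centre lies in its closure. *)
pose d := Num.min (Num.min e1 e2) (Num.min e3 e4).
have d0 : 0 < d by rewrite !lt_min e10 e20 e30 e40.
have d1 : 0 < d <= e1 by rewrite d0 !ge_min lexx.
have d2 : 0 < d <= e2 by rewrite d0 !ge_min lexx orbT.
have d3 : 0 < d <= e3 by rewrite d0 !ge_min lexx !orbT.
have d4 : 0 < d <= e4 by rewrite d0 !ge_min lexx !orbT.
under eq_bigl do rewrite -(h1 d d1).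
under [RHS]eq_bigl do rewrite -(h2 d d2).
apply: cnt => [||J]; try exact: cell_box.
have QE U : (exists y, [/\ realization R K y, forall i, i \in J -> E i y & U y]) <->
    (exists y, Q J y /\ U y).
  by split => -[y]; [move=> [? ? ?]|move=> [[? ?] ?]]; exists y.
rewrite QE (QE (fun y => box (f x) d (f y))) (h3 J d d3) (h4 J d d4).
(* Continuity of [f], and then of [g], transports the closure condition. *)
split => near r r0.
  have [r' r'0 hr'] := within_continuous_coord fc Kx r0.
  have [y [[Ky Ey] hy]] := near r' r'0; exists y; split => //; exact: hr'.
have [r' r'0 hr'] := within_continuous_coord gc (fK _ Kx) r0.
have [y [[Ky Ey] hy]] := near r' r'0; exists y; split => //.
by rewrite /box /= -(gf x)// -(gf y)//; apply: hr' => //; exact: fK.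
Qed.

Lemma sum_interval_expr (A : comNzRingType) (T : finType) (t S : {set T}) (x : A) :
  t \subset S ->
  \sum_(s : {set T} | (t \subset s) && (s \subset S)) x ^+ #|s| =
  x ^+ #|t| * (1 + x) ^+ #|S :\: t|.
Proof.
move=> tS; rewrite -sum_subsets_expr mulr_sumr.
rewrite (reindex_onto (fun J => t :|: J) (fun s => s :\: t)); last first.
  by move=> s /andP[ts _]; rewrite -[RHS](finset.setID s t) (finset.setIidPr ts).
apply: eq_big => [J|J]; rewrite ?finset.subsetUl ?finset.subUset ?tS /=.
  rewrite finset.setDUl finset.setDv finset.set0U subsetD; congr andb.
  by rewrite (sameP eqP finset.setDidPl).
move=> /andP[_ /eqP JE]; rewrite cardsU.
have -> : t :&: J = finset.set0.
  rewrite -JE finset.setIC finset.setDE -finset.setIA [_ :&: t]finset.setIC.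
  by rewrite finset.setICr finset.setI0.
by rewrite cards0 subn0 exprD.
Qed.

(** * Local Euler relations in a combinatorial manifold *)

Lemma simplicial_complex_boundary n : simplicial_complex (simplex_boundary n).
Proof.
split; first by rewrite inE eqxx.
move=> s t; rewrite !inE => /andP[s0 sT] ts t0; rewrite t0 /=.
apply: contra sT => /eqP tT; move: ts; rewrite tT finset.subTset; exact.
Qed.

Lemma sum_above_simplex_boundary n (t : {set 'I_n.+1}) :
  t \in simplex_boundary n ->
  \sum_(s in simplex_boundary n | t \subset s) (-1) ^+ #|s| = (-1) ^+ n :> int.
Proof.
rewrite inE => /andP[t0 tT].
have := sum_interval_expr (-1 : int) (finset.subsetT t).
rewrite subrr expr0n.
have -> : (#|[set: 'I_n.+1] :\: t| == 0)%N = false.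
  by rewrite cards_eq0 finset.setD_eq0 finset.subTset; exact: negPf.
rewrite mulr0 (bigD1 [set: 'I_n.+1]%SET) ?finset.subsetT//= cardsT card_ord => /eqP.
rewrite addrC addr_eq0 exprS mulN1r opprK => /eqP <-; apply: eq_bigl => s.
rewrite !inE finset.subsetT andbT; have [ts|] := boolP (t \subset s); last by rewrite andbF.
rewrite andbT; suff -> : s != finset.set0 by [].
by apply: contraNneq t0 => s0; move: ts; rewrite s0 finset.subset0.
Qed.

Lemma sum_simplex_boundary n :
  \sum_(s in simplex_boundary n) (-1) ^+ #|s| = (-1) ^+ n - 1 :> int.
Proof.
have := alternating_sum_subsets (S := [set: 'I_n.+1]%SET).
rewrite -card_gt0 cardsT card_ord => /(_ isT).
rewrite (bigD1 [set: 'I_n.+1]%SET) /=; last first.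
  by rewrite finset.subsetT andbT -card_gt0 cardsT card_ord.
rewrite cardsT card_ord => /eqP; rewrite addrC eq_sym -subr_eq exprS mulN1r opprK addrC => /eqP ->.
by apply: eq_bigl => s; rewrite inE finset.subsetT andbT.
Qed.

Lemma link_complex (V : finType) (K : {set {set V}}) v :
  simplicial_complex K -> simplicial_complex (link K v).
Proof.
move=> [K0 Ks]; split; first by rewrite inE (negPf K0).
move=> s t; rewrite !inE => /and3P[sK vs vsK] ts t0.
apply/and3P; split; [exact: Ks sK ts t0|exact: contra (fintype.subsetP ts v) vs|].
apply: Ks vsK _ _; first exact: finset.setUS.
by apply/set0Pn; exists v; rewrite !inE eqxx.
Qed.

Section Sphere.
Variables (R : realType) (n : nat) (V : finType) (L : {set {set V}}).
Hypothesis cL : simplicial_complex L.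
Hypothesis sphL : PL_sphere_pred R n L.

Lemma PL_sphere_euler : \sum_(s in L) (-1) ^+ #|s| = (-1) ^+ n - 1 :> int.
Proof.
have [f [g [fg fPL _]]] := sphL.
rewrite (PL_homeomorphic_euler fg fPL)// ?sum_simplex_boundary//.
exact: simplicial_complex_boundary.
Qed.

(** In the boundary of a simplex the sum is the same for every face, so it does not matter into
    which open face a point of the open simplex [t] is mapped. *)
Lemma PL_sphere_local_euler t : t \in L ->
  \sum_(s in L | t \subset s) (-1) ^+ #|s| = (-1) ^+ n :> int.
Proof.
move=> tL; have t0 : t != finset.set0 by apply: contraNneq cL.1 => <-.
have [f [g [fg fPL [gc _]]]] := sphL; have [fK _ _ _] := fg.
have [x xt] := open_simplex_inhabited R t0.
have Lx : realization R L x by apply/realizationE; rewrite (open_simplex_support xt).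
have /realizationE[t'B fxt] := fK _ Lx.
by rewrite (PL_homeomorphic_local_euler fg fPL gc tL xt fxt) sum_above_simplex_boundary.
Qed.

Lemma PL_sphere_dim_le s : s \in L -> (#|s| <= n)%N.
Proof.
move=> sL; have [f [g [fg fPL _]]] := sphL.
have [t] := PL_homeomorphic_dim fg fPL cL.1 sL; rewrite inE => /andP[_ tT] st.
apply: leq_trans st _; rewrite -ltnS.
have := proper_card (A := t) (B := [set: 'I_n.+1]%SET); rewrite cardsT card_ord; apply.
by rewrite finset.properEneq tT finset.subsetT.
Qed.

Lemma PL_sphere_dim_ge : (0 < n)%N -> exists2 s, s \in L & (n <= #|s|)%N.
Proof.
move=> n0; have [f [g [[fK gK gf fgE] _ gPL]]] := sphL.
have gf' : mutually_inverse (realization R (simplex_boundary n)) (realization R L) g f by [].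
pose t : {set 'I_n.+1} := [set~ ord0]%SET.
have tn : #|t| = n by rewrite cardsC1 card_ord.
have tB : t \in simplex_boundary n.
  rewrite inE -card_gt0 tn n0 /=; apply/eqP => /setP/(_ ord0).
  by rewrite !inE eqxx.
have [s sL ts] := PL_homeomorphic_dim gf' gPL (simplicial_complex_boundary n).1 tB.
by exists s; rewrite // -tn.
Qed.

End Sphere.

Section Manifold.
Variables (R : realType) (n : nat) (V : finType) (K : {set {set V}}).
Hypothesis cK : simplicial_complex K.
Hypothesis sphK : forall v, [set v]%SET \in K -> PL_sphere_pred R n (link K v).

Lemma simplex_vertex s v : s \in K -> v \in s -> [set v]%SET \in K.
Proof.
move=> sK vs; apply: cK.2 sK _ _; first by rewrite finset.sub1set.
by apply/set0Pn; exists v; rewrite inE.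
Qed.

Lemma mem_link v s : s != finset.set0 ->
  (s \in link K v) = (v \notin s) && (v |: s \in K)%SET.
Proof.
move=> s0; rewrite inE; apply: andb_idl => /andP[vs vsK].
by apply: cK.2 vsK _ s0; exact: finset.subsetUr.
Qed.

(** Removing a vertex [v] of [s] identifies the simplices around [s] with those around [s :\ v] in
    the link of [v], where the local relation of a sphere applies. If [v] is all of [s], the empty
    set appears as well and completes the Euler sum of the link. *)
Lemma manifold_local_euler s : s \in K ->
  \sum_(t in K | s \subset t) (-1) ^+ #|t| = (-1) ^+ n.+1 :> int.
Proof.
move=> sK; have /set0Pn[v vs] : s != finset.set0 by apply: contraNneq cK.1 => <-.
have sphL := sphK (simplex_vertex sK vs).
have cL := link_complex v cK; set L := link K v in sphL cL.
transitivity (- \sum_(t : {set V} |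
  [&& v \notin t, v |: t \in K & s :\ v \subset t]%SET) (-1) ^+ #|t| : int).
  rewrite -sumrN (reindex_onto (fun t => v |: t)%SET (fun t => t :\ v)%SET) /=; last first.
    by move=> t /andP[_ st]; rewrite finset.setD1K// (fintype.subsetP st).
  apply: eq_big => [t|t /andP[_ /eqP tE]]; last first.
    have vt : v \notin t by rewrite -tE !inE eqxx.
    by rewrite cardsU1 vt exprS mulN1r.
  have -> : ((v |: t) :\ v == t)%SET = (v \notin t).
    apply/eqP/idP => [<-|vt]; first by rewrite !inE eqxx.
    by rewrite finset.setU1K.
  by rewrite finset.subDset andbC.
have [sv|sv] := eqVneq (s :\ v)%SET finset.set0.
  rewrite (bigD1 finset.set0) /=; last first.
    rewrite inE sv finset.sub0set andbT/= finset.setU0; exact: simplex_vertex sK vs.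
  rewrite cards0 expr0 (eq_bigl (mem L)); last first.
    move=> t; rewrite sv finset.sub0set andbT; case: eqVneq => [->|t0] /=.
      by rewrite andbF (negPf cL.1).
    by rewrite andbT mem_link.
  by rewrite (PL_sphere_euler cL sphL) exprS addrC subrK mulN1r.
rewrite (eq_bigl (fun t => (t \in L) && (s :\ v \subset t)))%SET.
  rewrite (PL_sphere_local_euler cL sphL) ?exprS ?mulN1r//.
  by rewrite mem_link// !inE eqxx finset.setD1K.
move=> t; have [st|] := boolP (s :\ v \subset t)%SET; last by rewrite !andbF.
rewrite !andbT mem_link//; apply: contraNneq sv => t0.
by move: st; rewrite t0 finset.subset0.
Qed.

Lemma manifold_dim_le s : s \in K -> (#|s| <= n.+1)%N.
Proof.
move=> sK; have /set0Pn[v vs] : s != finset.set0 by apply: contraNneq cK.1 => <-.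
rewrite (cardsD1 v) vs ltnS.
have [sv|sv] := eqVneq (s :\ v)%SET finset.set0; first by rewrite sv cards0.
apply: (PL_sphere_dim_le (link_complex v cK) (sphK (simplex_vertex sK vs))).
by rewrite mem_link// !inE eqxx finset.setD1K.
Qed.

Lemma manifold_facet : K != finset.set0 -> exists2 s, s \in K & #|s| = n.+1.
Proof.
case/set0Pn => t tK; have /set0Pn[v vt] : t != finset.set0 by apply: contraNneq cK.1 => <-.
have vK := simplex_vertex tK vt.
suff [s sK ns] : exists2 s, s \in K & (n.+1 <= #|s|)%N.
  by exists s => //; apply/eqP; rewrite eqn_leq ns manifold_dim_le.
(* In dimension 0 the links are empty and a vertex is already a facet. *)
have [n0|n0] := posnP n; first by exists [set v]%SET; rewrite // cards1 n0.
have [s sL ns] := PL_sphere_dim_ge (sphK vK) n0.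
exists (v |: s)%SET; first by move: sL; rewrite inE => /and3P[].
by move: sL; rewrite inE cardsU1 => /and3P[_ -> _].
Qed.

End Manifold.

(** * Polytopes and composition of PL maps *)

Lemma convex_hull_sub (R : realType) m k (p : 'I_k -> 'rV[R]_m) (C : set 'rV[R]_m) :
  convex_set C -> (forall i, C (p i)) -> convex_hull p `<=` C.
Proof.
move=> cC Cp x [t [t0 t1 ->]].
by have [] // := @affine_on_sum R m m C id k p t.
Qed.

Lemma polytope_convex (R : realType) m (P : set 'rV[R]_m) : polytope P -> convex_set P.
Proof. by move=> [k [p ->]]; exact: convex_hull_convex. Qed.

Lemma polytope_image (R : realType) m m' (P : set 'rV[R]_m)
    (f : 'rV[R]_m -> 'rV[R]_m') :
  polytope P -> affine_on P f -> polytope (f @` P).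
Proof.
move=> [k [p PE]] af; exists k, (f \o p).
have cP : convex_set P by rewrite PE; exact: convex_hull_convex.
have Pp i : P (p i) by rewrite PE; exact: convex_hull_vertex.
apply/seteqP; split => [_ [x Px <-]|y [t [t0 t1 ->]]].
  have [t [t0 t1 ->]] : convex_hull p x by rewrite -PE.
  by have [_ ->] := affine_on_sum cP af Pp t0 t1; exists t.
by have [Ps <-] := affine_on_sum cP af Pp t0 t1; exists (\sum_i t i *: p i).
Qed.

(* The vertices of a hyperplane section lie at vertices of the polytope, or
   where a segment joining two vertices crosses the hyperplane. *)
Lemma polytope_cut (R : realType) m (P : set 'rV[R]_m) (c : 'I_m) :
  polytope P -> polytope (P `&` [set x | x ord0 c = 0]).
Proof.
move=> [k [p PE]]; pose l i := p i ord0 c.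
pose S : {pred 'I_k + 'I_k * 'I_k} := fun a => match a with
  | inl i => l i == 0 | inr ij => (0 < l ij.1) && (l ij.2 < 0) end.
pose q (a : 'I_k + 'I_k * 'I_k) := match a with
  | inl i => p i
  | inr (i, j) => (l i - l j)^-1 *: (- l j *: p i + l i *: p j) end.
exists #|S|, (fun a => q (enum_val a)); apply/seteqP; split; last first.
  apply: convex_hull_sub => [|a].
    apply: convex_setI; first by rewrite PE; exact: convex_hull_convex.
    by move=> x y t /= x0 y0 _; rewrite !mxE x0 y0 !mulr0 addr0.
  have := enum_valP a; case: (enum_val a) => [i|[i j]]; rewrite unfold_in /=.
    by move=> /eqP li; split => //; rewrite PE; exact: convex_hull_vertex.
  move=> /andP[i0 j0]; have d0 : 0 < l i - l j by lra.
  split; last by rewrite !mxE -/(l i) -/(l j); ring.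
  rewrite scalerDr !scalerA.
  have -> : (l i - l j)^-1 * l i = 1 - (l i - l j)^-1 * - l j.
    by field; rewrite gt_eqF.
  rewrite PE; apply: convex_hull_convex; try exact: convex_hull_vertex.
  rewrite mulrC divr_ge0 ?ler_pdivrMr ?mul1r//; lra.
move=> x [] /[1!PE] -[t [t0 t1 xE]] /= x0.
(* On the hyperplane the positive and negative parts of the coordinate balance; [la] is their common
   total. *)
pose la := \sum_(i | 0 < l i) t i * l i.
have split3 (M : nmodType) (F : 'I_k -> M) : \sum_i F i =
    \sum_(i | l i == 0) F i + (\sum_(i | 0 < l i) F i + \sum_(i | l i < 0) F i).
  rewrite (bigID (fun i => l i == 0))/=; congr (_ + _).
  rewrite (bigID (fun i => 0 < l i))/=; congr (_ + _); apply: eq_bigl => i.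
    by case: ltgtP.
  by case: ltgtP.
have laE : la = \sum_(j | l j < 0) t j * - l j.
  have : \sum_i t i * l i = 0.
    by rewrite -[RHS]x0 xE summxE; apply: eq_bigr => i _; rewrite mxE.
  rewrite split3 big1 ?add0r => [|i /eqP->]; last by rewrite mulr0.
  move/eqP; rewrite addr_eq0 => /eqP; rewrite -/la => ->; rewrite -sumrN.
  by apply: eq_bigr => i _; rewrite mulrN.
(* If [la] is 0, then so is [la / la], but in this case all weights off the hyperplane vanish
   too. *)
have wP i : l i != 0 -> t i * (la / la) = t i.
  move=> li; have [la0|la0] := eqVneq la 0; last by rewrite divff ?mulr1.
  suff -> : t i = 0 by rewrite mul0r.
  move: li; have [li|li|//] := ltgtP (l i) 0 => _.
    have /eqP := esym laE; rewrite la0 psumr_eq0 => [|j lj]; last by rewrite mulr_ge0//; lra.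
    move=> /allP/(_ i); rewrite mem_index_enum li => /(_ isT) /=.
    by rewrite mulf_eq0 oppr_eq0 (lt_eqF li) orbF => /eqP.
  have /eqP := la0; rewrite psumr_eq0 => [|j lj]; last by rewrite mulr_ge0// ltW.
  move=> /allP/(_ i); rewrite mem_index_enum li => /(_ isT) /=.
  by rewrite mulf_eq0 (gt_eqF li) orbF => /eqP.
(* The mass off the hyperplane is spread over the pairs like a product measure, scaled so that each
   vertex recovers its weight. *)
pose w (a : 'I_k + 'I_k * 'I_k) := match a with
  | inl i => t i | inr ij => t ij.1 * t ij.2 * (l ij.1 - l ij.2) / la end.
(* For a general module this yields both the sum of the weights, with [h] constantly 1, and the
   point itself. *)
have wsum (M : lmodType R) (h : 'I_k -> M) :
    \sum_(i | l i == 0) t i *: h i +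
    \sum_(ij : 'I_k * 'I_k | (0 < l ij.1) && (l ij.2 < 0))
      (t ij.1 * t ij.2 * (l ij.1 - l ij.2) / la) *:
        ((l ij.1 - l ij.2)^-1 *: (- l ij.2 *: h ij.1 + l ij.1 *: h ij.2)) =
    \sum_i t i *: h i.
  rewrite [RHS]split3; congr (_ + _).
  transitivity (\sum_(i | 0 < l i) \sum_(j | l j < 0)
      ((t i / la * (t j * - l j)) *: h i + (t j / la * (t i * l i)) *: h j)).
    rewrite pair_big /=; apply: eq_bigr => -[i j] /= /andP[i0 j0].
    have d0 : l i - l j != 0 by rewrite gt_eqF//; lra.
    rewrite !scalerDr !scalerA; set u := la^-1.
    by congr (_ *: _ + _ *: _); field.
  under eq_bigr do rewrite big_split /=.
  rewrite big_split /=; congr (_ + _).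
    apply: eq_bigr => i i0; rewrite -scaler_suml -mulr_sumr -laE.
    by rewrite mulrAC -mulrA wP// gt_eqF.
  rewrite exchange_big /=; apply: eq_bigr => j j0.
  rewrite -scaler_suml -mulr_sumr -/la.
  by rewrite mulrAC -mulrA wP// lt_eqF.
have sumS (M : nmodType) (F : 'I_k + 'I_k * 'I_k -> M) :
    \sum_(a < #|S|) F (enum_val a) = \sum_(i | l i == 0) F (inl i) +
      \sum_(ij | (0 < l ij.1) && (l ij.2 < 0)) F (inr ij).
  transitivity (\sum_(a in S) F a); first by rewrite (@big_enum_val _ _ _ _ S F). 
  by rewrite big_mkcond big_sumType /= -!big_mkcond.
exists (fun a => w (enum_val a)); split => [a||].
- have := enum_valP a; case: (enum_val a) => [i|[i j]]; rewrite unfold_in //=.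
  move=> /andP[i0 j0]; rewrite !mulr_ge0 ?invr_ge0//; first lra.
  by apply: sumr_ge0 => i' i'0; rewrite mulr_ge0// ltW.
- have scale_one (a : R) : a *: (1 : R^o) = a by exact: mulr1.
  rewrite (sumS _ w) /= -t1; transitivity (\sum_i t i *: (1 : R^o)).
    rewrite -wsum; congr (_ + _); first by apply: eq_bigr => i _; rewrite scale_one.
    apply: eq_bigr => -[i j] /= /andP[i0 j0].
    have d0 : l i - l j != 0 by rewrite gt_eqF//; lra.
    by rewrite -scalerDl scale_one [- l j + l i]addrC -[_^-1 *: _]/(_^-1 * _) mulVf// scale_one.
  by apply: eq_bigr => i _; rewrite scale_one.
- rewrite (sumS _ (fun a => w a *: q a)) /= xE -wsum; congr (_ + _).
  by apply: eq_bigr => -[i j].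
Qed.

Lemma polytope_cuts (R : realType) m (P : set 'rV[R]_m) (s : seq 'I_m) :
  polytope P -> polytope (P `&` [set x | forall c, c \in s -> x ord0 c = 0]).
Proof.
move=> pP; elim: s => [|c s IH].
  suff -> : P `&` [set x | forall c, c \in [::] -> x ord0 c = 0] = P by [].
  by apply/seteqP; split => x // [].
have := polytope_cut c IH; congr polytope; apply/seteqP; split => x /=.
  move=> [[Px xs] xc]; split => // c'; rewrite inE => /orP[/eqP->//|]; exact: xs.
move=> [Px xs]; split; last by apply: xs; rewrite mem_head.
by split => // c' c's; apply: xs; rewrite inE c's orbT.
Qed.

(** The pairs of [x] in [P] and [f x - y] with [y] in [Q] form a polytope; cutting it where the
    second component vanishes and projecting to the first leaves exactly the [x] with [f x] in
    [Q]. *)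
Lemma polytope_preimage (R : realType) m m' (P : set 'rV[R]_m) (Q : set 'rV[R]_m')
    (f : 'rV[R]_m -> 'rV[R]_m') :
  polytope P -> affine_on P f -> polytope Q -> polytope (P `&` f @^-1` Q).
Proof.
move=> pP af pQ; have [k [p PE]] := pP; have [l [q QE]] := pQ.
have cP := polytope_convex pP; have cQ := polytope_convex pQ.
pose C := [set z : 'rV[R]_(m + m') | exists x y, [/\ P x, Q y & z = row_mx x (f x - y)]].
have pC : polytope C.
  pose r (a : 'I_k * 'I_l) := row_mx (p a.1) (f (p a.1) - q a.2).
  exists #|{: 'I_k * 'I_l}|, (fun a => r (enum_val a)); apply/seteqP; split; last first.
    apply: convex_hull_sub => [|a].
      move=> _ _ u [x [y [Px Qy ->]]] [x' [y' [Px' Qy' ->]]] u01.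
      exists (u *: x + (1 - u) *: x'), (u *: y + (1 - u) *: y'); split; [exact: cP|exact: cQ|].
      rewrite af// !scale_row_mx add_row_mx; congr row_mx.
      by rewrite !scalerBr addrACA opprD.
    exists (p (enum_val a).1), (q (enum_val a).2); split => //.
      by rewrite PE; exact: convex_hull_vertex.
    by rewrite QE; exact: convex_hull_vertex.
  move=> _ [x [y [Px Qy ->]]].
  have [t [t0 t1 xE]] : convex_hull p x by rewrite -PE.
  have [s [s0 s1 yE]] : convex_hull q y by rewrite -QE.
  have Pp i : P (p i) by rewrite PE; exact: convex_hull_vertex.
  have [_ fE] := affine_on_sum cP af Pp t0 t1.
  have sumE (M : nmodType) (F : 'I_k * 'I_l -> M) :
      \sum_(a < #|{: 'I_k * 'I_l}|) F (enum_val a) = \sum_i \sum_j F (i, j).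
    rewrite pair_big /= -(big_enum_val (A := {: 'I_k * 'I_l}) F).
    by apply: eq_bigr => -[].
  exists (fun a => t (enum_val a).1 * s (enum_val a).2); split => [a||].
  - by rewrite mulr_ge0.
  - rewrite (sumE _ (fun a => t a.1 * s a.2)) -t1 /=.
    by apply: eq_bigr => i _; rewrite -mulr_sumr s1 mulr1.
  - rewrite (sumE _ (fun a => (t a.1 * s a.2) *: r a)) /= /r.
    transitivity (\sum_i t i *: row_mx (p i) (f (p i) - y)).
      rewrite sum_scale_row_mx xE fE; congr row_mx.
      under [RHS]eq_bigr do rewrite scalerBr.
      by rewrite sumrB -scaler_suml t1 scale1r.
    apply: eq_bigr => i _; under [RHS]eq_bigr do rewrite -scalerA.
    rewrite -scaler_sumr; congr (_ *: _).
    rewrite (sum_scale_row_mx s (fun=> p i) (fun j => f (p i) - q j)).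
    rewrite -scaler_suml s1 scale1r; congr row_mx; under [RHS]eq_bigr do rewrite scalerBr.
    by rewrite sumrB -scaler_suml s1 scale1r yE.
have := polytope_image (polytope_cuts (map (@rshift m m') (enum 'I_m')) pC)
  (f := lsubmx) _.
suff -> : [set lsubmx z | z in C `&`
    [set x | forall c, c \in [seq rshift m i | i <- enum 'I_m'] -> x ord0 c = 0]] =
    P `&` f @^-1` Q.
  apply; move=> z z' u _ _ _; apply/rowP => c; by rewrite !mxE.
apply/seteqP; split => [_ [_ [[x [y [Px Qy ->]]] /= h] <-]|x [Px Qfx]].
  rewrite row_mxKl; split => //=; suff -> : f x = y by [].
  apply/eqP; rewrite -subr_eq0; apply/eqP/rowP => c.
  have := h (rshift m c); rewrite row_mxEr mxE => ->; rewrite ?mxE//.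
  by rewrite map_f// mem_enum.
exists (row_mx x 0); last by rewrite row_mxKl.
split => [|_ /mapP[c _ ->]] /=; last by rewrite row_mxEr mxE.
by exists x, (f x); rewrite subrr.
Qed.

Lemma mulmxr_continuous (R : realType) m p (A : 'M[R]_(m, p)) :
  continuous (fun x : 'rV[R]_m => x *m A).
Proof.
move=> x U /nbhs_ballP[e /= e0 eU]; apply/nbhs_ballP.
pose C := 1 + \sum_k \sum_j `|A k j|.
have C0 : 0 < C by rewrite ltr_pwDl// sumr_ge0// => k _; rewrite sumr_ge0.
exists (e / C) => /=; first exact: divr_gt0.
move=> y [_ yx]; apply: eU; split => // i j; rewrite !ord1 -ball_normE /=.
rewrite !mxE -sumrB; apply: le_lt_trans (ler_norm_sum _ _ _) _.
have h : \sum_k `|x ord0 k * A k j - y ord0 k * A k j| <=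
    \sum_k e / C * `|A k j|.
  apply: ler_sum => k _; rewrite -mulrBl normrM ler_wpM2r//.
  by have := yx ord0 k; rewrite -ball_normE /= => /ltW.
apply: le_lt_trans h _; rewrite -mulr_sumr mulrAC ltr_pdivrMr// ltr_pM2l//.
rewrite /C ltr_pwDl// ler_sum// => k _.
by rewrite (bigD1 j)//= lerDl sumr_ge0.
Qed.

Lemma convex_hull_compact (R : realType) m k (p : 'I_k -> 'rV[R]_m) :
  compact (convex_hull p).
Proof.
pose A : 'M[R]_(k, m) := \matrix_(i, j) p i ord0 j.
pose S := [set t : 'rV[R]_k | forall i, t ord0 i \in `[0, 1]] `&`
  (fun t : 'rV[R]_k => t *m (const_mx 1 : 'cV_k)) @^-1` [set 1%:M].
have cS : compact S.
  apply: compact_closedI.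
    have := @rV_compact R k (fun=> `[0, 1]%classic) (fun=> @segment_compact R 0 1).
    by congr compact.
  apply: closed_comp; first by move=> x _; exact: mulmxr_continuous.
  by apply: compact_closed; [exact: norm_hausdorff|exact: compact_set1].
have sumE (t : 'rV[R]_k) : t *m (const_mx 1 : 'cV_k) = 1%:M <-> \sum_i t ord0 i = 1.
  have e : (t *m (const_mx 1 : 'cV_k)) ord0 ord0 = \sum_i t ord0 i.
    by rewrite mxE; apply: eq_bigr => i _; rewrite mxE mulr1.
  split => [h|h]; first by rewrite -e h mxE.
  by apply/matrixP => i j; rewrite !ord1 e h mxE.
have -> : convex_hull p = [set t *m A | t in S].
  have AE (t : 'rV[R]_k) : t *m A = \sum_i t ord0 i *: p i.
    apply/rowP => j; rewrite mxE summxE; apply: eq_bigr => i _.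
    by rewrite !mxE.
  apply/seteqP; split => [x [t [t0 t1 ->]]|_ [t [t01 /sumE t1] <-]].
    exists (\row_i t i).
      split => [i /=|]; last by apply/sumE; under eq_bigr do rewrite mxE.
      by rewrite mxE in_itv /= t0 -t1 (bigD1 i)//= lerDl sumr_ge0.
    by rewrite AE; apply: eq_bigr => i _; rewrite mxE.
  exists (fun i => t ord0 i); split => // i.
  by have := t01 i; rewrite in_itv /= => /andP[].
apply: continuous_compact cS; apply: continuous_subspaceT; exact: mulmxr_continuous.
Qed.

Lemma polytopes_compact (R : realType) m k (P : 'I_k -> set 'rV[R]_m) :
  (forall i, polytope (P i)) -> compact (\bigcup_i P i).
Proof.
move=> pP; have -> : \bigcup_i P i = \big[setU/set0]_(i < k) P i.
  have := bigcup_pred (xpredT : {pred 'I_k}) P; rewrite big_mkcond /= => <-.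
  by apply/seteqP; split => x [i _ Px]; exists i.
by apply: bigsetU_compact => i _; have [l [p ->]] := pP i; exact: convex_hull_compact.
Qed.

Lemma compact_inverse_continuous (R : realType) m m' (A : set 'rV[R]_m)
    (B : set 'rV[R]_m') f g :
  mutually_inverse A B f g -> compact A -> {within A, continuous f} ->
  {within B, continuous g}.
Proof.
move=> [fA gB gf fg] cA cf; apply/subspace_continuousP => y By U.
rewrite nbhsE => -[N [oN Ny] NU].
pose S := A `&` ~` N.
have cS : compact (f @` S).
  apply: continuous_compact; first by apply: continuous_subspaceW cf => x [].
  by apply: compact_closedI => //; exact: open_closedC.
have clS : closed (f @` S) by apply: compact_closed => //; exact: norm_hausdorff.
have nS : (~` (f @` S)) y.
  by move=> [x [Ax nNx] fx]; apply: nNx; rewrite -(gf x)// fx.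
have : nbhs y (~` (f @` S)) by apply: open_nbhs_nbhs; split => //; exact: closed_openC.
apply: filterS => y' nS' By'; apply: NU; apply: contrapT => nN.
by apply: nS'; exists (g y'); [split => //; exact: gB|exact: fg].
Qed.

(** Continuity of the inverse comes from compactness, and its affine pieces are the images of those
    of [f]. This handles inverses with awkward formulas, such as the minimum that inverts a stellar
    subdivision. *)
Lemma PL_homeomorphicI (R : realType) m m' (A : set 'rV[R]_m) (B : set 'rV[R]_m')
    (f : 'rV[R]_m -> 'rV[R]_m') g : mutually_inverse A B f g ->
  PL_on A f -> PL_homeomorphic A B.
Proof.
move=> fgi fPL; exists f, g; split => //; have [cf [k [P [AE hP]]]] := fPL.
split.
  apply: compact_inverse_continuous fgi _ cf.
  by rewrite AE; apply: polytopes_compact => i; exact: (hP i).1.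
exists k, (fun i => f @` P i); split.
  rewrite -image_bigcup -AE; have [fA gB gf fg] := fgi.
  by apply/seteqP; split => [y By|_ [x Ax <-]]; [exists (g y); [exact: gB|exact: fg]|exact: fA].
move=> i; have [pP af] := hP i; split; first exact: polytope_image.
move=> _ _ t [x Px <-] [y Py <-] t01; rewrite -af//.
have sub z : P i z -> A z by rewrite AE; exists i.
have [_ _ gf _] := fgi; rewrite !gf//; try exact: sub.
by apply: sub; apply: polytope_convex.
Qed.

Lemma PL_homeomorphic_sym (R : realType) m m' (A : set 'rV[R]_m) (B : set 'rV[R]_m') :
  PL_homeomorphic A B -> PL_homeomorphic B A.
Proof. by move=> [f [g [[? ? ? ?] ? ?]]]; exists g, f. Qed.

Lemma within_continuous_comp (T S U : topologicalType) (A : set T) (B : set S)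
    (f : T -> S) (h : S -> U) : (forall x, A x -> B (f x)) ->
  {within A, continuous f} -> {within B, continuous h} ->
  {within A, continuous (h \o f)}.
Proof.
move=> fA /subspace_continuousP cf /subspace_continuousP ch.
apply/subspace_continuousP => x Ax W hW.
have near : \forall y \near nbhs x, A y -> B (f y) -> W (h (f y)).
  exact: (cf x Ax _ (ch (f x) (fA x Ax) W hW)).
suff : \forall y \near nbhs x, A y -> W (h (f y)) by [].
by apply: filterS near => y h1 Ay; exact: (h1 Ay (fA _ Ay)).
Qed.

(** The composite is affine on each [P i] cut with the preimage of a [Q j]. Links in a subdivision
    are reached from a sphere in several steps, hence the need to compose. *)
Lemma PL_homeomorphic_trans (R : realType) m m' m'' (A : set 'rV[R]_m)
    (B : set 'rV[R]_m') (C : set 'rV[R]_m'') :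
  PL_homeomorphic A B -> PL_homeomorphic B C -> PL_homeomorphic A C.
Proof.
move=> [f [g [[fA gB gf fg] [cf [k [P [AE hP]]]] _]]].
move=> [h [l [[hB lC lh hl] [ch [k' [Q [BE hQ]]]] _]]].
apply: (@PL_homeomorphicI _ _ _ _ _ (h \o f) (g \o l)).
  split => [x /fA/hB//|y /lC/gB//|x Ax|y Cy] /=.
    by rewrite lh ?gf//; exact: fA.
  by rewrite fg ?hl//; exact: lC.
split; first exact: within_continuous_comp cf ch.
pose F (a : 'I_k * 'I_k') := P a.1 `&` f @^-1` Q a.2.
exists #|{: 'I_k * 'I_k'}|, (fun a => F (enum_val a)); split.
  apply/seteqP; split => [x Ax|x [a _ [Px _]]]; last by rewrite AE; exists (enum_val a).1.
  have [i _ Px] : (\bigcup_i P i) x by rewrite -AE.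
  have [j _ Qx] : (\bigcup_i Q i) (f x) by rewrite -BE; exact: fA.
  by exists (enum_rank (i, j)) => //; rewrite enum_rankK.
move=> a; move: (enum_val a) => [i j]; have [pP af] := hP i; have [pQ ah] := hQ j.
split; first exact: polytope_preimage.
by move=> x y t [/= Px Qx] [/= Py Qy] t01; rewrite af// ah.
Qed.

(** * Simplicial maps *)

Lemma face_mx_coord (R : realType) (V : finType) (s : {set V}) (u : 'rV[R]_#|s|) i :
  (u *m face_mx R s) ord0 (enum_rank (enum_val i)) = u ord0 i.
Proof.
rewrite mxE (bigD1 i)//= !mxE eqxx mulr1 big1 ?addr0// => k ki.
by rewrite mxE (inj_eq enum_rank_inj) (inj_eq enum_val_inj) eq_sym (negPf ki) mulr0.
Qed.

Lemma closed_simplexE (R : realType) (V : finType) (s : {set V}) :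
  convex_hull (fun i => row i (face_mx R s)) =
  [set x | [/\ forall v, 0 <= x ord0 (enum_rank v),
      \sum_v x ord0 (enum_rank v) = 1
    & forall v, v \notin s -> x ord0 (enum_rank v) = 0]].
Proof.
have sumE (x : 'rV[R]_#|V|) : (forall v, v \notin s -> x ord0 (enum_rank v) = 0) ->
    \sum_v x ord0 (enum_rank v) = \sum_(i < #|s|) x ord0 (enum_rank (enum_val i)).
  move=> xs; rewrite -(big_enum_val (A := mem s) (fun v => x ord0 (enum_rank v))).
  rewrite [RHS]big_mkcond; apply: eq_bigr => v _.
  by case: ifPn => // /xs.
apply/seteqP; split => [x [t [t0 t1 xE]]|x [x0 x1 xs]].
  have {}xE : x = (\row_i t i) *m face_mx R s.
    by rewrite mulmx_sum_row xE; apply: eq_bigr => i _; rewrite mxE.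
  have xs v : v \notin s -> x ord0 (enum_rank v) = 0.
    by apply/sub_face_mx; rewrite xE submxMl.
  split => // [v|].
    have [vs|/xs->//] := boolP (v \in s).
    by rewrite -(enum_rankK_in vs vs) xE face_mx_coord mxE.
  by rewrite sumE// -t1; apply: eq_bigr => i _; rewrite xE face_mx_coord mxE.
have /sub_face_mx/submxP[u xE] := xs.
exists (fun i => u ord0 i); split => [i||].
- by rewrite -face_mx_coord -xE.
- rewrite -x1 sumE//; apply: eq_bigr => i _.
  by rewrite xE face_mx_coord.
- by rewrite xE mulmx_sum_row.
Qed.

Lemma realization_polytopes (R : realType) (V : finType) (K : {set {set V}}) :
  simplicial_complex K -> exists (k : nat) (P : 'I_k -> set 'rV[R]_#|V|),
  realization R K = \bigcup_i P i /\ forall i, polytope (P i).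
Proof.
move=> [K0 Ks].
exists #|K|, (fun i => convex_hull (fun j => row j (face_mx R (enum_val i)))).
split; last by move=> i; exists #|enum_val i|, (fun j => row j (face_mx R (enum_val i))).
apply/seteqP; split => [x [x0 x1 xK]|x [i _]].
  exists (enum_rank_in xK [set v | x ord0 (enum_rank v) != 0]%SET) => //.
  rewrite enum_rankK_in// closed_simplexE; split => // v.
  by rewrite inE => /negPn/eqP.
rewrite closed_simplexE => -[x0 x1 xs]; split => //.
apply: Ks (enum_valP i) _ _.
  apply/fintype.subsetP => v; rewrite inE; apply: contraR => /xs ->; exact/eqP.
apply/eqP => s0; have : \sum_v x ord0 (enum_rank v) = 0.
  apply: big1 => v _; have := finset.in_set0 v; rewrite -s0 inE => /negbFE/eqP.
  exact.
by rewrite x1 => /eqP; rewrite oner_eq0.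
Qed.

Lemma PL_homeomorphic_linear (R : realType) (V V' : finType) (K : {set {set V}})
    (K' : {set {set V'}}) (A : 'M[R]_(#|V|, #|V'|)) g :
  simplicial_complex K ->
  mutually_inverse (realization R K) (realization R K') (fun x => x *m A) g ->
  PL_homeomorphic (realization R K) (realization R K').
Proof.
move=> cK fg; apply: PL_homeomorphicI fg _; split.
  by apply: continuous_subspaceT; exact: mulmxr_continuous.
have [k [P [KE pP]]] := realization_polytopes R cK; exists k, P; split => // i.
by split => // x y t _ _ _; rewrite mulmxDl -!scalemxAl.
Qed.

Definition vertices (V : finType) (K : {set {set V}}) : {set V} :=
  [set v | [set v]%SET \in K]%SET.

Lemma simplex_vertices (V : finType) (K : {set {set V}}) s :
  simplicial_complex K -> s \in K -> s \subset vertices K.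
Proof.
move=> [_ Ks] sK; apply/fintype.subsetP => v vs; rewrite inE; apply: Ks sK _ _.
  by rewrite finset.sub1set.
by apply/set0Pn; exists v; rewrite inE.
Qed.

(** Injectivity is asked on vertices only: [boundary_join_sphere] uses a map that identifies the new
    vertex with an element that is no vertex of the complex. *)
Lemma PL_homeomorphic_imset (R : realType) (V V' : finType) (K : {set {set V}})
    (h : V -> V') :
  simplicial_complex K -> {in vertices K &, injective h} ->
  PL_homeomorphic (realization R K)
    (realization R [set h @: (s : {set V}) | s in K]%SET).
Proof.
move=> cK inj; have [K0 Ks] := cK.
pose A : 'M[R]_(#|V|, #|V'|) := \matrix_(i, j) (enum_val j == h (enum_val i))%:R.
(* The default 0 outside the vertices matters, since such an element may share its image with a
   vertex. *)
pose g (y : 'rV[R]_#|V'|) : 'rV[R]_#|V| :=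
  \row_i if enum_val i \in vertices K then y ord0 (enum_rank (h (enum_val i))) else 0.
have AE (x : 'rV_#|V|) w : (x *m A) ord0 (enum_rank w) =
    \sum_(v | h v == w) x ord0 (enum_rank v).
  rewrite mxE [RHS]big_mkcond (reindex (@enum_rank V)) /=; last first.
    by exists enum_val => j _; rewrite ?enum_rankK ?enum_valK.
  apply: eq_bigr => v _; rewrite mxE !enum_rankK eq_sym.
  by case: eqP; rewrite ?mulr1 ?mulr0.
have gE (y : 'rV_#|V'|) v : g y ord0 (enum_rank v) =
    if v \in vertices K then y ord0 (enum_rank (h v)) else 0.
  by rewrite mxE enum_rankK.
have Kv x v : realization R K x -> v \notin vertices K -> x ord0 (enum_rank v) = 0.
  move=> [_ _ xK]; apply: contraNeq => xv.
  by apply: (fintype.subsetP (simplex_vertices cK xK)); rewrite inE.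
have fsupp x : realization R K x -> [set w | (x *m A) ord0 (enum_rank w) != 0]%SET =
    (h @: [set v | x ord0 (enum_rank v) != 0])%SET.
  move=> [x0 x1 xK]; apply/setP => w; rewrite inE AE psumr_eq0//.
  apply/allPn/imsetP => [[v _]|[v]]; rewrite ?inE.
    by rewrite negb_imply => /andP[/eqP <- xv]; exists v; rewrite // inE.
  by move=> xv ->; exists v; rewrite ?mem_index_enum// eqxx.
apply: (@PL_homeomorphic_linear R V V' K _ A g cK).
split => [x Kx|y [y0 y1 /imsetP[s sK yE]]|x Kx|y [y0 y1 /imsetP[s sK yE]]].
- have [x0 x1 xK] := Kx; split => [w||].
  + by rewrite AE sumr_ge0.
  + under eq_bigr do rewrite AE.
    rewrite -x1 [RHS](partition_big h xpredT)//=.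
  + by rewrite fsupp// imset_f.
- have sv := fintype.subsetP (simplex_vertices cK sK).
  have gs v : (g y ord0 (enum_rank v) != 0) = (v \in s).
    rewrite gE; case: ifP => [vK|vK]; last first.
      by rewrite eqxx; apply/esym/negbTE; apply: contraFN vK => /sv.
    have -> : (y ord0 (enum_rank (h v)) != 0) = (h v \in h @: s)%SET.
      by rewrite -yE inE.
    apply/imsetP/idP => [[u us /inj-> //]|vs]; [exact: sv|by exists v].
  split => [v||].
  + by rewrite gE; case: ifP.
  + rewrite -y1 (bigID (mem (h @: s)%SET))/= [X in _ = _ + X]big1 ?addr0; last first.
      by move=> w; rewrite -yE inE => /negPn/eqP.
    rewrite big_imset /=; last by move=> u v us vs; apply: inj; exact: sv.
    rewrite [RHS]big_mkcond; apply: eq_bigr => v _; case: ifPn => vs; last first.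
      by move: vs; rewrite -gs => /negPn/eqP.
    by rewrite gE sv.
  + suff -> : [set v | g y ord0 (enum_rank v) != 0]%SET = s by [].
    by apply/setP => v; rewrite inE gs.
- apply: eq_bary => v; rewrite gE; case: ifPn => [vK|/(Kv _ _ Kx)->//].
  rewrite AE (bigD1 v)//= big1 ?addr0// => u /andP[/eqP huv uv].
  have [uK|/(Kv _ _ Kx)//] := boolP (u \in vertices K).
  by rewrite (inj _ _ uK vK huv) eqxx in uv.
- have sv := fintype.subsetP (simplex_vertices cK sK).
  apply: eq_bary => w; rewrite AE.
  have [/imsetP[v vs ->]|ws] := boolP (w \in (h @: s)%SET).
    rewrite (bigD1 v)//= gE sv// big1 ?addr0// => u /andP[/eqP huv uv].
    rewrite gE; case: ifP => // uK.
    by rewrite (inj _ _ uK (sv _ vs) huv) eqxx in uv.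
  have yw : y ord0 (enum_rank w) = 0 by move: ws; rewrite -yE inE => /negPn/eqP.
  by rewrite yw big1// => v /eqP hv; rewrite gE hv yw; case: ifP.
Qed.

(** * Stellar subdivisions *)

Lemma big_option (A : nmodType) (V : finType) (F : option V -> A) :
  \sum_o F o = F None + \sum_v F (Some v).
Proof.
rewrite (bigD1 None)//=; congr (_ + _).
rewrite (reindex_omap Some id) => [|[v|]]//=.
by apply: eq_bigl => v; rewrite eqxx.
Qed.

Definition old (V : finType) (t : {set option V}) : {set V} := [set v | Some v \in t]%SET.

(* The new vertex is [None]. *)
Definition stellar (V : finType) (K : {set {set V}}) (s : {set V}) :
    {set {set option V}} :=
  [set t | ~~ (s \subset old t) &&
    (if None \in t then old t :|: s \in K else old t \in K)]%SET.

(** For a simplex [s] this is the join of the boundary of [s] with the link of [s], which becomes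
    the link of the new vertex when [s] is subdivided. *)
Definition rim (V : finType) (K : {set {set V}}) (s : {set V}) : {set {set V}} :=
  [set u | [&& u != finset.set0, ~~ (s \subset u) & u :|: s \in K]]%SET.

Section Stellar.
Variables (R : realType) (V : finType) (K : {set {set V}}) (s : {set V}).
Hypotheses (cK : simplicial_complex K) (s0 : s != finset.set0).

Lemma oldS (t u : {set option V}) : t \subset u -> old t \subset old u.
Proof. by move=> tu; apply/fintype.subsetP => v; rewrite !inE; apply: (fintype.subsetP tu). Qed.

Lemma setU_neq0 (u : {set V}) : (u :|: s)%SET != finset.set0.
Proof. by rewrite finset.setU_eq0 negb_and s0 orbT. Qed.

Lemma stellar_complex : simplicial_complex (stellar K s).
Proof.
have [K0 Ks] := cK; split.
  rewrite inE; have -> : old finset.set0 = finset.set0 :> {set V}.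
    by apply/setP => v; rewrite !inE.
  by rewrite !inE (negPf K0) andbF.
move=> u t; rewrite !inE => /andP[su uK] tu t0.
have otu := oldS tu; rewrite (contra _ su) /=; last first.
  by move/fintype.subset_trans; apply.
case: ifP => Nt.
  have Nu := fintype.subsetP tu _ Nt; rewrite Nu in uK.
  by apply: Ks uK _ (setU_neq0 _); exact: finset.setSU.
have ot0 : old t != finset.set0.
  case/set0Pn: t0 => -[v vt|]; last by rewrite Nt.
  by apply/set0Pn; exists v; rewrite inE.
case: ifP uK => _ uK; apply: Ks uK _ ot0 => //.
by apply: (fintype.subset_trans otu); exact: finset.subsetUl.
Qed.

(** The linear map places the new vertex at the barycentre of [s]. To invert it, the smallest
    coordinate over [s] is stripped from all vertices of [s] and the total is given to the new
    vertex; some vertex of [s] then has coordinate 0, as the subdivision demands. *)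
Lemma stellar_PL_homeomorphic :
  PL_homeomorphic (realization R (stellar K s)) (realization R K).
Proof.
have [K0 Ks] := cK.
have [w0 w0s] : exists w, w \in s by exact/set0Pn.
have sN0 : #|s|%:R != 0 :> R by rewrite pnatr_eq0 cards_eq0.
have sP : 0 < #|s|%:R :> R by rewrite ltr0n card_gt0.
pose A : 'M[R]_(#|{: option V}|, #|V|) := \matrix_(i, j)
  if enum_val i is Some v then (enum_val j == v)%:R
  else (enum_val j \in s)%:R / #|s|%:R.
have AE (x : 'rV_#|{: option V}|) w : (x *m A) ord0 (enum_rank w) =
    x ord0 (enum_rank (Some w)) + (w \in s)%:R * (x ord0 (enum_rank None) / #|s|%:R).
  rewrite mxE (reindex (@enum_rank (option V))) /=; last first.
    by exists enum_val => j _; rewrite ?enum_rankK ?enum_valK.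
  rewrite big_option addrC (bigD1 w)//= big1 ?addr0; last first.
    by move=> v vw; rewrite mxE !enum_rankK eq_sym (negPf vw) mulr0.
  by rewrite !mxE !enum_rankK eqxx mulr1 mulrCA.
pose mu (y : 'rV[R]_#|V|) : R :=
  y ord0 (enum_rank [arg min_(w < w0 in s) y ord0 (enum_rank w)]%O).
have muP y : exists2 w, w \in s & mu y = y ord0 (enum_rank w) /\
    forall v, v \in s -> y ord0 (enum_rank w) <= y ord0 (enum_rank v).
  by rewrite /mu; case: arg_minP => // w ws wmin; exists w.
pose g (y : 'rV[R]_#|V|) : 'rV[R]_#|{: option V}| := \row_i
  if enum_val i is Some v then y ord0 (enum_rank v) - (v \in s)%:R * mu y
  else #|s|%:R * mu y.
have gN y : g y ord0 (enum_rank None) = #|s|%:R * mu y by rewrite mxE enum_rankK.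
have gS y v : g y ord0 (enum_rank (Some v)) =
    y ord0 (enum_rank v) - (v \in s)%:R * mu y by rewrite mxE enum_rankK.
have sum_s : \sum_v (v \in s)%:R = #|s|%:R :> R.
  by rewrite -sum1_card natr_sum [RHS]big_mkcond; apply: eq_bigr => v _; case: (v \in s).
apply: (@PL_homeomorphic_linear R _ V (stellar K s) K A g stellar_complex).
split.
- move=> x [x0 x1 xK]; set t := [set v | _]%SET in xK.
  have old_t v : (v \in old t) = (x ord0 (enum_rank (Some v)) != 0) by rewrite !inE.
  split => [w||].
  + by rewrite AE addr_ge0 ?x0// mulr_ge0 ?divr_ge0// ?x0 ?ler0n.
  + under eq_bigr do rewrite AE.
    rewrite big_split/= -mulr_suml sum_s mulrC divfK//.
    by rewrite -[RHS]x1 big_option addrC.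
  + move: xK; rewrite inE => /andP[st]; rewrite inE; case: ifP => xN.
      congr (_ \in K); apply/setP => v; rewrite finset.in_setU old_t inE AE.
      rewrite paddr_eq0 ?x0//; last by rewrite mulr_ge0 ?divr_ge0 ?x0 ?ler0n.
      rewrite negb_and; case: (v \in s); last by rewrite mul0r eqxx.
      by rewrite mul1r mulf_eq0 invr_eq0 (negPf xN) (negPf sN0).
    move/negbFE/eqP: xN => xN.
    congr (_ \in K); apply/setP => v; rewrite old_t inE AE xN mul0r mulr0 addr0.
    by [].
- move=> y [y0 y1 yK]; set t := [set v | _]%SET in yK.
  have [w ws [muE wmin]] := muP y.
  have mu0 : 0 <= mu y by rewrite muE.
  have mule v : (v \in s)%:R * mu y <= y ord0 (enum_rank v).
    have [vs|vs] := boolP (v \in s); last by rewrite mul0r.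
    by rewrite mul1r muE wmin.
  split => [[v|]||].
  + by rewrite gS subr_ge0.
  + by rewrite gN mulr_ge0.
  + rewrite big_option gN; under eq_bigr do rewrite gS.
    by rewrite sumrB -mulr_suml sum_s y1 subrKC.
  + set t' := [set v | _]%SET.
    have old_t' v : (v \in old t') = (y ord0 (enum_rank v) - (v \in s)%:R * mu y != 0).
      by rewrite !inE gS.
    rewrite inE; apply/andP; split.
      apply/fintype.subsetPn; exists w => //.
      by rewrite old_t' ws mul1r muE subrr eqxx.
    rewrite inE gN mulf_eq0 (negPf sN0) /=.
    have [m0|m0] := eqVneq (mu y) 0; rewrite /=.
      suff -> : old t' = t by [].
      by apply/setP => v; rewrite old_t' m0 mulr0 subr0 inE.
    suff -> : (old t' :|: s)%SET = t by [].
    apply/setP => v; rewrite finset.in_setU old_t' inE.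
    have [vs|vs] := boolP (v \in s); last by rewrite mul0r subr0 orbF.
    rewrite orbT; apply/esym; rewrite gt_eqF//.
    by apply: lt_le_trans (mule v); rewrite vs mul1r lt_def m0.
- move=> x [x0 x1 xK].
  set t := [set v | _]%SET in xK; move: xK; rewrite inE => /andP[/fintype.subsetPn[w ws wt] _].
  have xw : x ord0 (enum_rank (Some w)) = 0 by move: wt; rewrite !inE => /negPn/eqP.
  have muE : mu (x *m A) = x ord0 (enum_rank None) / #|s|%:R.
    have [u us [-> umin]] := muP (x *m A); apply/eqP; rewrite eq_le; apply/andP; split.
      by have := umin w ws; rewrite [X in _ <= X]AE ws mul1r xw add0r.
    by rewrite AE us mul1r lerDr.
  apply: eq_bary => -[v|]; first by rewrite gS muE AE addrK.
  by rewrite gN muE mulrC divfK.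
- move=> y [y0 y1 yK]; apply: eq_bary => v.
  by rewrite AE gS gN [#|s|%:R * _]mulrC mulfK// subrK.
Qed.

Lemma rim_complex : simplicial_complex (rim K s).
Proof.
have [K0 Ks] := cK; split; first by rewrite inE eqxx.
move=> u t; rewrite !inE => /and3P[_ su uK] tu ->.
rewrite (contra _ su) /=; last by move/fintype.subset_trans; apply.
by apply: Ks uK _ (setU_neq0 _); exact: finset.setSU.
Qed.

Lemma old_Some (u : {set V}) : old (Some @: u)%SET = u.
Proof. by apply/setP => v; rewrite inE mem_imset// => ? ? []. Qed.

Lemma None_notin_Some (u : {set V}) : (None \in (Some @: u : {set option V})%SET) = false.
Proof. by apply/imsetP => -[]. Qed.

Lemma Some_old (t : {set option V}) : None \notin t -> (Some @: old t)%SET = t.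
Proof.
move=> Nt; apply/setP => -[v|]; last by rewrite None_notin_Some (negPf Nt).
by rewrite mem_imset ?inE// => ? ? [].
Qed.

Lemma old_None (t : {set option V}) : old (None |: t)%SET = old t.
Proof. by apply/setP => v; rewrite !inE. Qed.

Lemma link_stellar_None : link (stellar K s) None = [set Some @: (u : {set V}) | u in rim K s]%SET.
Proof.
have [K0 Ks] := cK; apply/setP => t; apply/idP/imsetP.
  rewrite inE => /and3P[tS Nt]; move: tS; rewrite !inE (negPf Nt) eqxx /= old_None.
  move=> /andP[st tK] /andP[_ tsK]; exists (old t); last by rewrite Some_old.
  by rewrite inE st tsK !andbT; apply: contraNneq K0 => <-.
move=> [u]; rewrite inE => /and3P[u0 su uK] ->.
rewrite !inE old_None old_Some None_notin_Some su uK /=.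
by rewrite (Ks _ _ uK)// finset.subsetUl.
Qed.

Lemma old_SomeU w (t : {set option V}) : old (Some w |: t)%SET = (w |: old t)%SET.
Proof. by apply/setP => v; rewrite !inE. Qed.

(** One formula covers all positions of [w]: if [s :\ w] is no simplex of the link, its subdivision
    only renames vertices by [Some]. When [s] is the singleton of [w], the vertex [w] disappears. *)
Lemma link_stellar_Some w : s != [set w]%SET ->
  link (stellar K s) (Some w) = stellar (link K w) (s :\ w)%SET.
Proof.
have [K0 Ks] := cK; move=> sw.
have sw0 : (s :\ w)%SET != finset.set0.
  apply: contra sw; rewrite finset.setD_eq0 finset.subset1 (negPf s0) orbF.
  exact.
apply/setP => t; rewrite !inE old_SomeU finset.subDset /=.
set p := old t; have [sp|sp] /= := boolP (s \subset w |: p)%SET; first by rewrite !andbF.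
have -> /= : ~~ (s \subset p).
  by apply: contra sp => /fintype.subset_trans; apply; exact: finset.subsetUr.
have -> : (Some w \in t) = (w \in p) by rewrite inE.
have [wp|wp] := boolP (w \in p).
  by case: ifP => _; rewrite /= ?inE ?wp /= ?andbF.
case: ifP => _ //=; rewrite eqxx /=.
have -> : (w |: (p :|: s :\ w) = w |: p :|: s)%SET.
  apply/setP => v; rewrite !(finset.in_setU, finset.in_setD, finset.in_set1).
  by case: (v == w); case: (v \in p); case: (v \in s).
have [h|] := boolP (w |: p :|: s \in K)%SET; last by rewrite !andbF.
have sub (u : {set V}) : u \subset (p :|: s)%SET -> u \subset (w |: p :|: s)%SET.
  by move=> us; rewrite -finset.setUA finset.subsetU// us orbT.
rewrite !andbT (Ks _ _ h) ?setU_neq0 ?sub//; apply/esym/(Ks _ _ h).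
  by apply: sub; apply: finset.setUS; exact: finset.subsetDl.
by rewrite finset.setU_eq0 negb_and sw0 orbT.
Qed.

End Stellar.

(** * Transport of charts; boundaries of simplices and their joins *)

Lemma topological_manifold_homeomorphic (R : realType) n m m'
    (A : set 'rV[R]_m) (B : set 'rV[R]_m') (f : 'rV[R]_m -> 'rV[R]_m') g :
  mutually_inverse A B f g -> {within A, continuous f} -> {within B, continuous g} ->
  topological_manifold n A -> topological_manifold n B.
Proof.
move=> [fA gB gf fg] cf cg tA y By.
have [U [oU Ugy [h [l [[hA lB lh hl] ch cl]]]]] := tA (g y) (gB y By).
have [W [oW WE]] : exists W, open W /\ W `&` B = g @^-1` U `&` B.
  have oS : open (g @^-1` U : set (subspace B)).
    by move/continuousP: cg; apply.
  by have [W oW WE] := (open_subspaceP B (g @^-1` U)).1 oS; exists W.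
have WP z : B z -> W z <-> U (g z).
  move=> Bz; have /seteqP[WU UW] := WE.
  by split => hz; [have [] := WU z (conj hz Bz)|have [] := UW z (conj hz Bz)].
exists W; split => //; first exact/WP.
exists (h \o g), (f \o l); split.
- split => [z [Bz Wz]|z Tz|z [Bz Wz]|z Tz] /=.
  + by [].
  + have [Al Ul] := lB z Tz; split; first exact: fA.
    by apply/WP; [exact: fA|rewrite gf].
  + by rewrite lh ?fg//; split; [exact: gB|exact/WP].
  + by have [Al Ul] := lB z Tz; rewrite gf ?hl.
- apply: within_continuous_comp ch.
    by move=> z [Bz Wz]; split; [exact: gB|exact/WP].
  by apply: continuous_subspaceW cg => z [].
- apply: within_continuous_comp lB cl _.
  by apply: continuous_subspaceW cf => z [].
Qed.

Definition boundary (V : finType) (N : {set V}) : {set {set V}} :=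
  [set s | (s != finset.set0) && (s \proper N)]%SET.

Lemma boundary_complex (V : finType) (N : {set V}) : simplicial_complex (boundary N).
Proof.
split; first by rewrite inE eqxx.
move=> s t; rewrite !inE => /andP[_ sN] ts ->; exact: sub_proper_trans sN.
Qed.

Lemma boundary_sphere (R : realType) n (V : finType) (N : {set V}) :
  #|N| = n.+1 -> PL_sphere_pred R n (boundary N).
Proof.
move=> Nn; pose h (i : 'I_n.+1) : V := enum_val (cast_ord (esym Nn) i).
have hi : injective h by move=> i j /enum_val_inj/cast_ord_inj.
have hN i : h i \in N by exact: enum_valP.
have hs v : v \in N -> exists i, v = h i.
  move=> vN; exists (cast_ord Nn (enum_rank_in vN v)).
  by rewrite /h cast_ordK enum_rankK_in.
have hT : (h @: [set: 'I_n.+1])%SET = N.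
  apply/setP => v; apply/imsetP/idP => [[i _ ->]//|/hs[i ->]].
  by exists i; rewrite ?inE.
apply: PL_homeomorphic_sym; rewrite (_ : boundary N =
    [set h @: (s : {set 'I_n.+1}) | s in simplex_boundary n]%SET).
  by apply: PL_homeomorphic_imset; [exact: simplicial_complex_boundary|move=> ? ? _ _ /hi].
apply/setP => s; apply/idP/imsetP => [|[t]]; rewrite !inE.
  move=> /andP[s0 sN]; exists (h @^-1: s)%SET.
    rewrite inE; apply/andP; split.
      have /set0Pn[v vs] := s0; have [i vi] := hs v (fintype.subsetP (proper_sub sN) v vs).
      by apply/set0Pn; exists i; rewrite inE -vi.
    apply: contraTneq sN => sT; rewrite properE negb_and negbK; apply/orP; right.
    apply/fintype.subsetP => v /hs[i ->].
    by have := finset.in_setT i; rewrite -sT inE.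
  apply/setP => v; apply/idP/imsetP => [vs|[i]]; last by rewrite inE => ? ->.
  have [i vi] := hs v (fintype.subsetP (proper_sub sN) v vs).
  by exists i; rewrite // inE -vi.
move=> /andP[t0 tT] ->; rewrite imset_eq0 t0 /= -hT; apply/properP; split.
  by apply: imsetS; exact: finset.subsetT.
have /fintype.subsetPn[i _ it] : ~~ ([set: 'I_n.+1] \subset t)%SET by rewrite finset.subTset.
by exists (h i); [rewrite imset_f ?inE|rewrite mem_imset].
Qed.

Definition boundary_join (V : finType) (a b : {set V}) : {set {set V}} :=
  [set s | [&& s != finset.set0, s \subset a :|: b, ~~ (a \subset s) & ~~ (b \subset s)]]%SET.

(* The join of two boundaries of simplices is obtained from the boundary of a
   single simplex by one stellar subdivision. *)
Lemma boundary_join_sphere (R : realType) n (V : finType) (a b : {set V}) :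
  disjoint (mem a) (mem b) -> a != finset.set0 -> b != finset.set0 ->
  (#|a| + #|b| = n.+2)%N -> PL_sphere_pred R n (boundary_join a b).
Proof.
move=> dab a0 /set0Pn[v vb] abn.
have va : v \notin a by rewrite (disjointFl dab).
(* The vertex [v] of [b] is set aside to play the new vertex. If [b] is just [v], then [a] is [N],
   no face of the boundary, and the subdivision only renames. *)
pose N := ((a :|: b) :\ v)%SET.
have vN : v \notin N by rewrite !inE eqxx.
have Nn : #|N| = n.+1.
  have := cardsD1 v (a :|: b)%SET; rewrite cardsU (disjoint_setI0 dab) cards0 subn0 abn.
  by rewrite !inE vb orbT => -[].
have aN : a \subset N.
  by apply/fintype.subsetP => u ua; rewrite !inE ua andbT; apply: contraNneq va => <-.
pose h (o : option V) : V := if o is Some u then u else v.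
have hE (t : {set option V}) : (h @: t = if None \in t then v |: old t else old t)%SET.
  apply/setP => u; apply/imsetP/idP => [[[w|] wt ->]|] /=.
  - by case: ifP => _; rewrite !inE wt ?orbT.
  - by rewrite wt !inE eqxx.
  - case: ifP => Nt; rewrite !inE; last by move=> ut; exists (Some u).
    by case/orP => [/eqP ->|ut]; [exists None|exists (Some u)].
have cN := boundary_complex N.
apply: PL_homeomorphic_trans _ (boundary_sphere R Nn).
apply: PL_homeomorphic_trans _ (stellar_PL_homeomorphic R cN a0).
apply: PL_homeomorphic_sym; rewrite (_ : boundary_join a b =
    [set h @: (t : {set option V}) | t in stellar (boundary N) a]%SET).
  apply: PL_homeomorphic_imset; first exact: stellar_complex.
  have vertN u : Some u \in vertices (stellar (boundary N) a) -> u \in N.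
    rewrite inE inE finset.in_set1 /= inE => /andP[_ /andP[_ /proper_sub uN]].
    by apply: (fintype.subsetP uN); rewrite !inE.
  move=> [x|] [y|] // xv yv /= xy; first by rewrite xy.
    by have := vertN _ xv; rewrite xy (negPf vN).
  by have := vertN _ yv; rewrite -xy (negPf vN).
apply/setP => u; apply/idP/imsetP => [|[t]].
  rewrite inE => /and4P[u0 uab au bu].
  have pN : (u :\ v)%SET \subset N by exact: finset.setSD.
  have [vu|vu] := boolP (v \in u).
    exists (None |: Some @: (u :\ v))%SET; last first.
      by rewrite hE finset.setU11 old_None old_Some finset.setD1K.
    rewrite inE finset.setU11 old_None old_Some; apply/andP; split.
      by apply: contra au => /fintype.subset_trans; apply; exact: finset.subD1set.
    rewrite inE setU_neq0//= properE finset.subUset pN aN /=.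
    apply: contra bu => /fintype.subsetP Np; apply/fintype.subsetP => w wb.
    have [->//|wv] := eqVneq w v.
    have := Np w; rewrite !inE wv wb orbT => /(_ isT).
    by rewrite (disjointFl dab wb) orbF.
  exists (Some @: u)%SET; last by rewrite hE None_notin_Some old_Some.
  rewrite inE None_notin_Some old_Some au inE u0 properE.
  have -> : u \subset N.
    apply/fintype.subsetP => w wu; rewrite in_setD1 (fintype.subsetP uab)// andbT.
    by apply: contraNneq vu => <-.
  by apply: contra au; exact: fintype.subset_trans.
have Nab : N \subset (a :|: b)%SET by exact: finset.subD1set.
rewrite inE => /andP[at_ tN] uE; move: tN; rewrite {}uE hE inE.
case: ifP => Nt; rewrite !inE => /andP[p0 /properP[pN [w wN wp]]]; apply/and4P; split.
- by apply/set0Pn; exists v; rewrite !inE eqxx.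
- rewrite finset.subUset finset.sub1set !inE vb orbT /=.
  apply: fintype.subset_trans Nab; apply: fintype.subset_trans pN.
  exact: finset.subsetUl.
- apply: contra at_ => /fintype.subsetP av; apply/fintype.subsetP => x xa.
  by have := av x xa; rewrite in_setU1; case: eqP xa va => [->->|].
- apply: contra wp => /fintype.subsetP bv; rewrite finset.in_setU.
  move: wN; rewrite in_setD1 finset.in_setU => /andP[wv /orP[->|/bv]]; rewrite ?orbT//.
  by rewrite in_setU1 (negPf wv) /= => ->.
- by [].
- exact: fintype.subset_trans Nab.
- by [].
- apply: contra vN => /fintype.subsetP bp; apply: (fintype.subsetP pN); exact: bp.
Qed.

(** * Effect of subdivisions on face numbers *)

Section StellarManifold.
Variables (R : realType) (n : nat) (M : closed_manifold R n).
Variable s : {set vertex M}.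
Hypotheses (sM : s \in simplices M) (rimM : PL_sphere_pred R n (rim (simplices M) s)).

Let K := simplices M.
Let cK : simplicial_complex K := closed_manifold_complex M.

Let s0 : s != finset.set0.
Proof. by apply: contraNneq cK.1 => <-. Qed.

Lemma stellar_neq0 : stellar K s != finset.set0.
Proof.
apply/set0Pn; exists [set None]%SET; rewrite inE inE eqxx.
have -> : old [set None]%SET = finset.set0 :> {set vertex M}.
  by apply/setP => v; rewrite !inE.
by rewrite finset.subset0 s0 finset.set0U.
Qed.

Lemma stellar_top : topological_manifold n (realization R (stellar K s)).
Proof.
have [f [g [[fA gB gf fg] [cf _] [cg _]]]] := stellar_PL_homeomorphic R cK s0.
have inv : mutually_inverse (realization R K) (realization R (stellar K s)) g f by [].
apply: (topological_manifold_homeomorphic inv cg cf); exact: closed_manifold_top.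
Qed.

Lemma stellar_link v : [set v]%SET \in stellar K s ->
  PL_sphere_pred R n (link (stellar K s) v).
Proof.
case: v => [w|_].
  rewrite inE finset.in_set1 /= => /andP[sw wK].
  have oldw : old [set Some w]%SET = [set w]%SET by apply/setP => u; rewrite !inE.
  rewrite oldw in sw wK; rewrite link_stellar_Some//; last first.
    by apply: contraNneq sw => ->.
  apply: PL_homeomorphic_trans (closed_manifold_link wK).
  apply: stellar_PL_homeomorphic; first exact: link_complex.
  by rewrite finset.setD_eq0.
rewrite link_stellar_None//; apply: PL_homeomorphic_trans rimM.
apply: PL_homeomorphic_sym; apply: PL_homeomorphic_imset; first exact: rim_complex.
by move=> x y _ _ [].
Qed.

Definition stellar_manifold : closed_manifold R n :=
  ClosedManifold (stellar_complex cK s0) stellar_neq0 stellar_top stellar_link.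

Lemma stellar_manifold_PL : PL_isomorphic stellar_manifold M.
Proof. exact: stellar_PL_homeomorphic. Qed.

End StellarManifold.

Definition f_poly (V : finType) (K : {set {set V}}) : {poly int} :=
  \sum_(s in K) 'X^#|s|.

Lemma sum_set_option (A : nmodType) (V : finType) (G : {set option V} -> A) :
  \sum_t G t = \sum_(p : {set V}) G (Some @: p)%SET
    + \sum_(p : {set V}) G (None |: Some @: p)%SET.
Proof.
rewrite (bigID (fun t : {set option V} => None \in t))/= addrC; congr (_ + _).
  rewrite (reindex_onto (fun p : {set V} => Some @: p)%SET (@old V)) /=.
    by apply: eq_bigl => p; rewrite None_notin_Some old_Some eqxx.
  by move=> t; exact: Some_old.
rewrite (reindex_onto (fun p : {set V} => None |: Some @: p)%SET (@old V)) /=.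
  by apply: eq_bigl => p; rewrite finset.setU11 old_None old_Some eqxx.
move=> t Nt; apply/setP => -[v|]; rewrite !inE ?Nt//=.
by rewrite mem_imset ?inE// => ? ? [].
Qed.

(** The simplices containing [s] are lost; gained are the joins of the new vertex with the [p] in
    the rim, the empty [p] included. *)
Lemma f_poly_stellar (V : finType) (K : {set {set V}}) (s : {set V}) :
  f_poly (stellar K s) = f_poly K
    + 'X * (\sum_(p : {set V} | ~~ (s \subset p) && (p :|: s \in K)%SET) 'X^#|p|)
    - \sum_(p in K | s \subset p) 'X^#|p|.
Proof.
rewrite /f_poly big_mkcond sum_set_option -!big_mkcond /=.
have -> : \sum_(p in K) 'X^#|p| = \sum_(p in K | s \subset p) 'X^#|p| +
    \sum_(p in K | ~~ (s \subset p)) 'X^#|p| :> {poly int} by exact: bigID.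
rewrite addrAC [_ + _ - _]addrAC subrr add0r; congr (_ + _).
  apply: eq_big => [p|p _].
    by rewrite inE None_notin_Some old_Some andbC.
  by rewrite card_imset// => ? ? [].
rewrite mulr_sumr; apply: eq_big => [p|p _].
  by rewrite inE finset.setU11 old_None old_Some.
by rewrite cardsU1 None_notin_Some card_imset ?exprS// => ? ? [].
Qed.

(** Counts the proper subsets of a set of [k] elements by size, that is, the faces of the boundary
    of a simplex together with the empty face. *)
Definition boundary_poly k : {poly int} := (1 + 'X) ^+ k - 'X^k.

(** Gained is [x e_(n+1)], with [e_k] for [boundary_poly k], and lost is [x^(n+1)]; their difference
    is [x (1+x) e_n]. *)
Lemma f_poly_stellar_facet (V : finType) (K : {set {set V}}) (s : {set V}) n :
  simplicial_complex K -> s \in K -> #|s| = n.+1 ->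
  (forall u : {set V}, u \in K -> s \subset u -> u = s) ->
  f_poly (stellar K s) = f_poly K + 'X * (1 + 'X) * boundary_poly n.
Proof.
move=> [K0 Ks] sK sn smax; rewrite f_poly_stellar.
have -> : \sum_(p in K | s \subset p) 'X^#|p| = 'X^(n.+1) :> {poly int}.
  rewrite (big_pred1 s) ?sn// => p; apply/andP/eqP => [[pK /(smax _ pK)]//|->].
  by split.
have -> : \sum_(p : {set V} | ~~ (s \subset p) && (p :|: s \in K)%SET) 'X^#|p| =
    boundary_poly n.+1 :> {poly int}.
  rewrite /boundary_poly -{1}sn -(sum_subsets_expr s 'X).
  rewrite [X in _ = X - _](bigD1 s)//= sn addrAC subrr add0r.
  apply: eq_bigl => p; rewrite finset.eqEsubset negb_and.
  have [ps|nps] := boolP (p \subset s) => /=.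
    by rewrite (finset.setUidPr ps) sK andbT.
  apply/negbTE; rewrite negb_and; apply/orP; right; apply: contra nps => psK.
  by rewrite -(smax _ psK (finset.subsetUr _ _)) finset.subsetUl.
by rewrite /boundary_poly !exprS; ring.
Qed.

(** The hypothesis on [u :|: a] says that the link of [a] is the boundary of [b]. Gained is
    [x e_(k+1) e_l] and lost is [x^(k+1) e_l]: the identity for a facet, multiplied by [e_l]. *)
Lemma f_poly_stellar_join (V : finType) (K : {set {set V}}) (a b : {set V}) k l :
  disjoint (mem a) (mem b) -> #|a| = k.+1 -> #|b| = l -> b != finset.set0 ->
  (forall u : {set V}, (u :|: a \in K)%SET =
     (u \subset a :|: b)%SET && ~~ (b \subset u)) ->
  f_poly (stellar K a) = f_poly K + 'X * (1 + 'X) * (boundary_poly k * boundary_poly l).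
Proof.
move=> dab ak bl b0 star; rewrite f_poly_stellar.
have cab : #|(a :|: b)%SET| = (k.+1 + l)%N.
  by rewrite cardsU (disjoint_setI0 dab) cards0 subn0 ak bl.
have aab : a \subset (a :|: b)%SET by exact: finset.subsetUl.
have bab : b \subset (a :|: b)%SET by exact: finset.subsetUr.
have dba : disjoint (mem b) (mem a) by rewrite disjoint_sym.
have sup_a := sum_interval_expr ('X : {poly int}) aab.
have sup_b := sum_interval_expr ('X : {poly int}) bab.
rewrite finset.setDUl finset.setDv finset.set0U (finset.setDidPl dba) ak bl in sup_a.
rewrite finset.setDUl finset.setDv finset.setU0 (finset.setDidPl dab) ak bl in sup_b.
have all := sum_subsets_expr (a :|: b)%SET ('X : {poly int}); rewrite cab in all.
have -> : \sum_(p in K | a \subset p) 'X^#|p| = 'X^(k.+1) * boundary_poly l :> {poly int}.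
  rewrite /boundary_poly mulrBr -sup_a [in RHS](bigD1 (a :|: b)%SET) /=; last first.
    by rewrite aab fintype.subxx.
  rewrite cab exprD addrAC subrr add0r; apply: eq_bigl => p.
  have [ap|] := boolP (a \subset p); rewrite ?andbF// andbT /=.
  rewrite -(finset.setUidPl ap) star (finset.setUidPl ap); apply: andb_id2l => pab.
  by rewrite finset.eqEsubset pab /= finset.subUset ap.
have -> : \sum_(p : {set V} | ~~ (a \subset p) && (p :|: a \in K)%SET) 'X^#|p| =
    boundary_poly k.+1 * boundary_poly l :> {poly int}.
  (* Inclusion and exclusion for the subsets of [a :|: b] that contain neither [a] nor [b]. *)
  transitivity ((1 + 'X) ^+ (k.+1 + l) - 'X^(k.+1) * (1 + 'X) ^+ l -
      ('X^l * (1 + 'X) ^+ k.+1 - 'X^(k.+1 + l)) : {poly int}); last first.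
    by rewrite /boundary_poly !exprD; ring.
  pose T (P : pred {set V}) : {poly int} := \sum_(p : {set V} | P p) 'X^#|p|.
  have TE P Q : T P = T (fun p => P p && Q p) + T (fun p => P p && ~~ Q p) by exact: bigID.
  have Teq P Q : P =1 Q -> T P = T Q by exact: eq_bigl.
  have e1 := TE (fun p => p \subset a :|: b)%SET (fun p => a \subset p).
  have e2 := TE (fun p => (p \subset a :|: b)%SET && ~~ (a \subset p)) (fun p => b \subset p).
  have e3 := TE (fun p => (b \subset p) && (p \subset a :|: b))%SET (fun p => a \subset p).
  have full : T (fun p => [&& b \subset p, p \subset a :|: b & a \subset p]%SET) =
      'X^(k.+1 + l).
    rewrite /T (big_pred1 (a :|: b)%SET) ?cab// => p /=.
    by rewrite finset.eqEsubset finset.subUset andbCA [(b \subset p) && _]andbC.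
  rewrite -/(T _) in sup_a; rewrite -/(T _) in sup_b; rewrite -/(T _) in all.
  have sa : T (fun p => (p \subset a :|: b)%SET && (a \subset p)) = 'X^(k.+1) * (1 + 'X) ^+ l.
    by rewrite -sup_a; apply: Teq => p; rewrite andbC.
  have sb : T (fun p => (b \subset p) && (p \subset a :|: b)%SET && ~~ (a \subset p)) =
      T (fun p => (p \subset a :|: b)%SET && ~~ (a \subset p) && (b \subset p)).
    by apply: Teq => p; rewrite -andbA andbC.
  transitivity (T (fun p => (p \subset a :|: b)%SET && ~~ (a \subset p) && ~~ (b \subset p))).
    by apply: Teq => p; rewrite star andbA [~~ _ && _]andbC.
  have full' : T (fun p => (b \subset p) && (p \subset a :|: b)%SET && (a \subset p)) =
      'X^(k.+1 + l) by rewrite -full; apply: Teq => p; rewrite andbA.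
  rewrite -all -sup_b -sa e1 e2 e3 sb full'; ring.
by rewrite /boundary_poly !exprS; ring.
Qed.

Section Manifold.
Variables (R : realType) (n : nat) (M : closed_manifold R n).
Let K := simplices M.
Let cK : simplicial_complex K := closed_manifold_complex M.
Let sphK := @closed_manifold_link R n M.

Lemma f_poly_coef k : (f_poly K)`_k.+1 = (f_number M k)%:R.
Proof.
rewrite /f_poly coef_sum /f_number -sumr_const big_mkcond [RHS]big_mkcond.
apply: eq_bigr => s _; rewrite coefXn inE eq_sym.
by case: (s \in K); case: eqP.
Qed.

Lemma f_poly_coef0 : (f_poly K)`_0 = 0.
Proof.
rewrite coef_sum big1// => s sK; rewrite coefXn eq_sym cards_eq0.
by case: eqP sK => // ->; rewrite (negPf cK.1).
Qed.

Lemma size_f_poly : (size (f_poly K) <= n.+2)%N.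
Proof.
apply: leq_trans (size_sum _ _ _) _; apply/bigmax_leqP => s sK.
by rewrite size_polyXn ltnS; apply: (manifold_dim_le cK sphK).
Qed.

(** Up to sign, a power of [-1 - 'X] counts the subsets of [s]. Exchanging the sums leaves a local
    Euler sum at each nonempty [t], while the empty [t] collects the constant. *)
Lemma f_poly_reflect :
  f_poly K \Po (-1 - 'X) = (-1) ^+ n.+1 *: f_poly K - (euler_characteristic M)%:P.
Proof.
rewrite /f_poly raddf_sum /=.
transitivity (\sum_(s in K) \sum_(t : {set vertex M} | t \subset s) (-1) ^+ #|s| *: 'X^#|t|
    : {poly int}).
  apply: eq_bigr => s _; rewrite rmorphXn /= comp_polyX -opprD [LHS]exprNn.
  rewrite -sum_subsets_expr -scaler_sumr -signr_odd -[in RHS]signr_odd.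
  by case: (odd _); rewrite ?expr0 ?expr1 ?scale1r ?mul1r// scaleN1r mulN1r.
rewrite (exchange_big_dep xpredT)//= (bigD1 finset.set0)//= addrC; congr (_ + _).
  rewrite scaler_sumr [RHS]big_mkcond /= [RHS](bigD1 finset.set0)//= (negPf cK.1) add0r.
  apply: eq_bigr => t t0; rewrite -scaler_suml; case: ifPn => tK.
    by rewrite (manifold_local_euler cK sphK tK).
  rewrite big1 ?scale0r// => s /andP[sK ts].
  by case/negP: tK; exact: cK.2 sK ts t0.
under eq_bigr do rewrite cards0 expr0 alg_polyC.
rewrite -raddf_sum -[RHS]raddfN /= -sumrN; congr (_%:P).
apply: eq_big => [s|s]; first by rewrite finset.sub0set andbT.
move=> /andP[sK _]; have : (0 < #|s|)%N.
  by rewrite card_gt0; apply: contraNneq cK.1 => <-.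
by case: #|s| => // k _; rewrite exprS mulN1r.
Qed.

Lemma facet_maximal (s u : {set vertex M}) :
  #|s| = n.+1 -> u \in K -> s \subset u -> u = s.
Proof.
move=> sn uK su; apply/esym/eqP; rewrite eqEcard su sn.
exact: (manifold_dim_le cK sphK).
Qed.

Lemma rim_facet s : s \in K -> #|s| = n.+1 -> PL_sphere_pred R n (rim K s).
Proof.
move=> sK sn; suff -> : rim K s = boundary s by exact: boundary_sphere.
apply/setP => u; rewrite !inE properE; case: (u != finset.set0) => //=.
rewrite andbC; congr andb; apply/idP/idP => [usK|us].
  by rewrite -(facet_maximal sn usK (finset.subsetUr _ _)) finset.subsetUl.
by rewrite (finset.setUidPr us).
Qed.

End Manifold.

Lemma rim_join (V : finType) (K : {set {set V}}) (a b : {set V}) :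
  (forall u : {set V}, (u :|: a \in K)%SET =
     (u \subset a :|: b)%SET && ~~ (b \subset u)) ->
  rim K a = boundary_join a b.
Proof.
move=> star; apply/setP => u; rewrite !inE star; case: (u != finset.set0) => //=.
by rewrite andbCA.
Qed.

(** A cone over the boundary of [s] replaces the facet. In it, the join of the new vertex with [r]
    is completed by the proper subsets of the opposite face [s :\: r]. *)
Lemma stellar_star (V : finType) (K : {set {set V}}) (s r : {set V}) :
  simplicial_complex K -> s \in K ->
  (forall u : {set V}, u \in K -> s \subset u -> u = s) ->
  r \subset s -> s != finset.set0 ->
  let a := (None |: Some @: r)%SET in let b := (Some @: (s :\: r))%SET in
  forall u : {set option V}, (u :|: a \in stellar K s)%SET =
     (u \subset a :|: b)%SET && ~~ (b \subset u).
Proof.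
move=> cK sK smax rs s0 a b u.
have -> : (a :|: b = None |: Some @: s)%SET.
  rewrite -finset.setUA -imsetU; suff -> : (r :|: s :\: r = s)%SET by [].
  by rewrite -[RHS](finset.setID s r) (finset.setIidPr rs).
have olda : old (u :|: a)%SET = (old u :|: r)%SET.
  by apply/setP => v; rewrite !inE /= mem_imset// => ? ? [].
have -> : (b \subset u) = (s \subset old u :|: r)%SET.
  rewrite finset.setUC -finset.subDset; apply/fintype.subsetP/fintype.subsetP => h v.
    by move=> vsr; rewrite inE; apply: h; rewrite mem_imset// => ? ? [].
  by move=> /imsetP[w wsr ->]; have := h w wsr; rewrite inE.
have -> : (u \subset None |: Some @: s)%SET = (old u \subset s).
  apply/fintype.subsetP/fintype.subsetP => h v.
    by rewrite inE => /h; rewrite !inE /= mem_imset// => ? ? [].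
  by case: v => [v|] vu; rewrite !inE //= mem_imset ?h ?inE// => ? ? [].
rewrite inE olda inE finset.in_setU1 eqxx orbT andbC; congr andb.
rewrite -finset.setUA (finset.setUidPr rs); apply/idP/idP => [usK|us].
  by rewrite -(smax _ usK (finset.subsetUr _ _)) finset.subsetUl.
by rewrite (finset.setUidPr us).
Qed.

Lemma exists_subset_card (V : finType) (s : {set V}) k : (k <= #|s|)%N ->
  exists2 r : {set V}, r \subset s & #|r| = k.
Proof.
rewrite -bin_gt0 -cards_draws card_gt0 => /set0Pn[r].
by rewrite inE => /andP[rs /eqP rk]; exists r.
Qed.

Notation Y := ('X * (1 + 'X) : {poly int}).

Lemma facet_move (R : realType) n (M : closed_manifold R n) :
  exists M' : closed_manifold R n, PL_isomorphic M' M /\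
    f_poly (simplices M') = f_poly (simplices M) + Y * boundary_poly n.
Proof.
have cK := closed_manifold_complex M; have sphK := @closed_manifold_link R n M.
have [s sK sn] := manifold_facet cK sphK (closed_manifold_nonempty M).
exists (stellar_manifold sK (rim_facet sK sn)); split; first exact: stellar_manifold_PL.
by apply: f_poly_stellar_facet => // u uK; exact: facet_maximal.
Qed.

(** The simplex [a] has [j.+1] vertices, the new one included, and the opposite face [b] has
    [n.+1 - j], a positive number as [j <= n]. The middle term stems from the preparatory
    subdivision of the facet. *)
Lemma join_move (R : realType) n (M : closed_manifold R n) j : (0 < j <= n)%N ->
  exists M' : closed_manifold R n, PL_isomorphic M' M /\
    f_poly (simplices M') = f_poly (simplices M) + Y * boundary_poly n +
      Y * (boundary_poly j * boundary_poly (n.+1 - j)).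
Proof.
move=> /andP[j0 jn].
have cK := closed_manifold_complex M; have sphK := @closed_manifold_link R n M.
have [s sK sn] := manifold_facet cK sphK (closed_manifold_nonempty M).
have smax u (uK : u \in simplices M) := facet_maximal sn uK.
have s0 : s != finset.set0 by rewrite -card_gt0 sn.
have [|r rs rj] := @exists_subset_card _ s j; first by rewrite sn ltnW.
pose M' := stellar_manifold sK (rim_facet sK sn).
pose a : {set vertex M'} := (None |: Some @: r)%SET.
pose b : {set vertex M'} := (Some @: (s :\: r))%SET.
have star := stellar_star cK sK smax rs s0.
have aj : #|a| = j.+1 by rewrite cardsU1 None_notin_Some card_imset ?rj// => ? ? [].
have bj : #|b| = (n.+1 - j)%N.
  rewrite card_imset => [|? ? [] //]; rewrite cardsD (finset.setIidPr rs).
  by rewrite sn rj.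
have b0 : b != finset.set0 by rewrite -card_gt0 bj subn_gt0 ltnS.
have a0 : a != finset.set0 by rewrite -card_gt0 aj.
have dab : [disjoint a & b]%B.
  rewrite -setI_eq0; apply/eqP/setP => -[v|]; rewrite !inE /= ?None_notin_Some//.
  rewrite !mem_imset ?inE => [|? ? [] //|? ? [] //].
  by case: (v \in r).
have aM' : a \in simplices M'.
  have := star finset.set0; rewrite finset.set0U => ->.
  by rewrite finset.sub0set finset.subset0.
have rimM' : PL_sphere_pred R n (rim (simplices M') a).
  rewrite (rim_join star); apply: boundary_join_sphere => //.
  by rewrite aj bj; lia.
exists (stellar_manifold aM' rimM'); split.
  apply: PL_homeomorphic_trans (stellar_manifold_PL sK (rim_facet sK sn)).
  exact: stellar_manifold_PL.
rewrite /= (f_poly_stellar_join dab aj bj b0 star).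
by rewrite (f_poly_stellar_facet cK sK sn smax).
Qed.

(** * The lattice of face number changes *)

(** The substitution is the reflection about -1/2, which exchanges 0 and -1. *)
Definition reflects m (p : {poly int}) : Prop := p \Po (-1 - 'X) = (-1) ^+ m *: p.

Lemma reflect_Y : ('X * (1 + 'X) : {poly int}) \Po (-1 - 'X) = 'X * (1 + 'X).
Proof. by rewrite comp_polyM comp_polyD comp_polyX rmorph1; ring. Qed.

Lemma reflectsB m p q : reflects m p -> reflects m q -> reflects m (p - q).
Proof. by rewrite /reflects comp_polyB scalerBr => -> ->. Qed.

Lemma reflectsZ m c p : reflects m p -> reflects m (c *: p).
Proof. by rewrite /reflects comp_polyZ => ->; rewrite !scalerA mulrC. Qed.

Lemma reflects_boundary k : reflects k.+1 (boundary_poly k).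
Proof.
rewrite /reflects /boundary_poly comp_polyB !rmorphXn /= comp_polyD comp_polyX rmorph1.
have -> : 1 + (-1 - 'X) = - 'X :> {poly int} by ring.
rewrite -opprD [X in X - _]exprNn [X in _ - X]exprNn exprS mulN1r scaleNr.
rewrite -[in LHS]signr_odd -[in RHS]signr_odd; case: (odd k).
  by rewrite !expr1 scaleN1r !mulN1r !opprK addrC.
by rewrite !expr0 scale1r !mul1r opprB.
Qed.

(** The symmetry turns the root 0 into a root -1, and the quotient by the invariant polynomial
    ['X * (1 + 'X)] inherits the symmetry. *)
Lemma reflects_factor m (p : {poly int}) : reflects m p -> p`_0 = 0 ->
  exists q, [/\ p = 'X * (1 + 'X) * q, reflects m q &
    forall k, (size p <= k.+2)%N -> (size q <= k)%N].
Proof.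
move=> pr p0.
have r0 : p.[0] = 0 by rewrite horner_coef0.
have r1 : p.[-1] = 0.
  have : (p \Po (-1 - 'X)).[0] = 0 by rewrite pr hornerZ r0 mulr0.
  by rewrite horner_comp !hornerE ?subr0.
have /factor_theorem[q1 pE] : root p 0 by apply/eqP.
have /factor_theorem[q q1E] : root q1 (-1).
  apply/eqP; move: r1; rewrite pE !hornerE => /eqP.
  by rewrite ?subr0 mulf_eq0 orbF => /eqP.
have pY : p = 'X * (1 + 'X) * q.
  by rewrite pE q1E polyC0 subr0 rmorphN1 opprK; ring.
have Y0 : 'X * (1 + 'X) != 0 :> {poly int}.
  apply/eqP => /(congr1 (fun r : {poly int} => r.[1])); rewrite !hornerE.
  by [].
exists q; split => //.
  apply: (mulfI Y0); move: pr; rewrite /reflects pY comp_polyM reflect_Y => ->.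
  by rewrite scalerAr.
move=> k; have [->|q0] := eqVneq q 0; first by rewrite size_poly0.
rewrite pE q1E !size_Mmonic ?monicXsubC// ?mulf_neq0 ?polyXsubC_eq0//.
by rewrite !size_XsubC !addn2.
Qed.

Lemma size_boundary_poly k : (size (boundary_poly k) <= k)%N.
Proof.
have s1 : size (1 + 'X : {poly int}) = 2%N by rewrite addrC size_XaddC.
have m1 : (1 + 'X : {poly int}) \is monic by rewrite addrC monicXaddC.
have mk := monic_exp k m1.
have sk : size ((1 + 'X : {poly int}) ^+ k) = k.+1.
  by rewrite -[LHS]prednK ?size_poly_gt0 ?monic_neq0// size_exp s1 mul1n.
apply/leq_sizeP => i; rewrite leq_eqVlt => /orP[/eqP <-|ki]; rewrite coefB coefXn.
  rewrite eqxx; have /monicP := mk; rewrite lead_coefE sk /= => ->; exact: subrr.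
by rewrite gtn_eqF// subr0 nth_default// sk.
Qed.

Lemma boundary_poly_coef0 k : (0 < k)%N -> (boundary_poly k)`_0 = 1.
Proof.
by move=> k0; rewrite -horner_coef0 /boundary_poly !hornerE expr1n expr0n gtn_eqF// subr0.
Qed.

Section Lattice.
Variables (n : nat) (H : {poly int} -> Prop).
Hypothesis H0 : H 0.
Hypothesis HD : forall p q, H p -> H q -> H (p + q).
Hypothesis HN : forall p, H p -> H (- p).
Hypothesis HS : forall j, (0 < j <= n)%N ->
  H ('X * (1 + 'X) * (boundary_poly j * boundary_poly (n.+1 - j))).

Lemma lattice_scale (c : int) p : H p -> H (c *: p).
Proof.
move=> Hp; have Hn (k : nat) : H (k%:Z *: p).
  elim: k => [|k IH]; first by rewrite scale0r.
  by rewrite intS scalerDl scale1r; exact: HD.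
case: c => k; first exact: Hn.
by rewrite NegzE scaleNr; apply: HN; exact: Hn.
Qed.

Lemma lattice_telescope m j : (0 < m)%N -> (m + j.*2 = n)%N ->
  H (('X * (1 + 'X)) ^+ j.+1 * boundary_poly m).
Proof.
move=> m0 mj.
have -> : ('X * (1 + 'X)) ^+ j.+1 * boundary_poly m =
   'X * (1 + 'X) * (boundary_poly j.+1 * boundary_poly (n.+1 - j.+1)) +
   - ('X * (1 + 'X) * (boundary_poly j * boundary_poly (n.+1 - j))) :> {poly int}.
  have -> : (n.+1 - j.+1 = m + j)%N by lia.
  have -> : (n.+1 - j = (m + j).+1)%N by lia.
  by rewrite /boundary_poly !exprS !exprD exprMn; ring.
apply: HD; first by apply: HS; lia.
(* For [j = 0] the generator lies outside the range of [HS], but it is 0 because [boundary_poly 0]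
   is. *)
apply: HN; case: j mj => [|j] mj; last by apply: HS; lia.
by rewrite {1}/boundary_poly !expr0 subrr mul0r mulr0.
Qed.

Lemma reflective_lattice m j (b : {poly int}) :
  (m + j.*2 = n)%N -> (size b <= m)%N -> reflects m.+1 b ->
  H (('X * (1 + 'X)) ^+ j.+1 * b).
Proof.
elim/ltn_ind: m j b => m IH j b mj sb rb.
have [m0|m0] := posnP m.
  move: sb; rewrite m0 leqn0 size_poly_eq0 => /eqP ->; by rewrite mulr0.
(* Since [boundary_poly m] has constant term 1, an integral multiple of it clears the constant term
   of [b]. *)
pose b1 := b - b`_0 *: boundary_poly m.
have b1r : reflects m.+1 b1.
  by apply: reflectsB => //; apply: reflectsZ; exact: reflects_boundary.
have b10 : b1`_0 = 0 by rewrite coefB coefZ boundary_poly_coef0// mulr1 subrr.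
have sb1 : (size b1 <= m)%N.
  apply: leq_trans (size_polyD _ _) _; rewrite size_polyN geq_max sb /=.
  exact: leq_trans (size_scale_leq _ _) (size_boundary_poly m).
have [q [b1E qr sq]] := reflects_factor b1r b10.
have -> : ('X * (1 + 'X)) ^+ j.+1 * b =
    b`_0 *: (('X * (1 + 'X)) ^+ j.+1 * boundary_poly m) + ('X * (1 + 'X)) ^+ j.+2 * q.
  have bE : b = b`_0 *: boundary_poly m + 'X * (1 + 'X) * q.
    by rewrite -b1E /b1 addrC subrK.
  by rewrite [in LHS]bE mulrDr -scalerAr mulrA -exprSr.
apply: HD; first by apply: lattice_scale; exact: lattice_telescope.
have {}sq k : (m <= k.+2)%N -> (size q <= k)%N by move=> mk; exact/sq/(leq_trans sb1).
clear b1 b1r b10 b1E sb1 sb rb.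
(* The size bound drops by 2 while [j] grows by 1, which keeps [m + j.*2]; for [m = 1] the quotient
   is already 0. *)
case: m m0 mj sq qr IH => [//|[|m]] _ mj sq qr IH.
  by have := sq 0%N isT; rewrite leqn0 size_poly_eq0 => /eqP ->; rewrite mulr0.
apply: (IH m) => //; [lia|exact: sq|].
by move: qr; rewrite /reflects !exprS !mulN1r !opprK.
Qed.

End Lattice.

Theorem theorem1p4 (R : realType)
    (Phi : forall n : nat, closed_manifold R n -> R)
    (Phi_PL : forall (n n' : nat)
       (M : closed_manifold R n) (M' : closed_manifold R n'),
       PL_isomorphic M M' -> Phi n M = Phi n' M')
    (Phi_f : forall (n n' : nat)
       (M : closed_manifold R n) (M' : closed_manifold R n'),
       f_vector M = f_vector M' -> Phi n M = Phi n' M')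
    (n : nat) (M1 M2 : closed_manifold R n) :
  euler_characteristic M1 = euler_characteristic M2 ->
  Phi n M1 = Phi n M2.
Proof.
pose F (M : closed_manifold R n) := f_poly (simplices M).
pose good (p : {poly int}) := forall M M' : closed_manifold R n,
  F M - F M' = p -> Phi n M = Phi n M'.
(* The equivalence for all [p] makes [H] closed under negation, hence a subgroup, although
   subdivisions only add. *)
pose H (e : {poly int}) := forall p, good p <-> good (p + e).
have H0 : H 0 by move=> p; rewrite addr0.
have HD p q : H p -> H q -> H (p + q).
  by move=> hp hq r; rewrite addrA -hq -hp.
have HN p : H p -> H (- p).
  by move=> hp r; rewrite (hp (r - p)) subrK.
have HM e : (forall M : closed_manifold R n, exists M' : closed_manifold R n,
    PL_isomorphic M' M /\ F M' = F M + e) -> H e.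
  (* The difference is lowered by [e] through a move on [M'] and raised by [e] through a move on
     [M]. *)
  move=> move_e p; split => gp M M' MM'.
    have [M'' [/Phi_PL <- M''E]] := move_e M'.
    by apply: gp; rewrite M''E opprD addrA MM' addrK.
  have [M'' [/Phi_PL <- M''E]] := move_e M.
  by apply: gp; rewrite M''E addrAC MM'.
have HS j : (0 < j <= n)%N ->
    H ('X * (1 + 'X) * (boundary_poly j * boundary_poly (n.+1 - j))).
  (* The second subdivision always comes with that of a facet; the subgroup property isolates its
     own contribution. *)
  move=> jn; have h1 := HM _ (@facet_move R n).
  have h2 : H ('X * (1 + 'X) * boundary_poly n +
      'X * (1 + 'X) * (boundary_poly j * boundary_poly (n.+1 - j))).
    apply: HM => M; have [M' [? ME]] := join_move M jn.
    by exists M'; split => //; rewrite /F ME addrA.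
  by have := HD _ _ h2 (HN _ h1); rewrite addrAC subrr add0r.
have good0 : good 0.
  move=> M M' /eqP; rewrite subr_eq0 => /eqP FE; apply: Phi_f.
  apply: eq_mkseq => k; have := f_poly_coef M k; rewrite -/(F M) FE f_poly_coef.
  by move=> /eqP; rewrite !natz eqz_nat => /eqP.
move=> chi; pose a := F M1 - F M2.
have ar : reflects n.+1 a.
  rewrite /reflects comp_polyB !f_poly_reflect chi scalerBr opprB addrA.
  by rewrite addrNK.
have a0 : a`_0 = 0 by rewrite coefB !f_poly_coef0 subrr.
have sa : (size a <= n.+2)%N.
  apply: leq_trans (size_polyD _ _) _; rewrite size_polyN geq_max.
  by rewrite !size_f_poly.
have [b [aE br sb]] := reflects_factor ar a0.
have Ha : H a.
  have := reflective_lattice H0 HD HN HS (j := 0) (addn0 n) (sb n sa) br.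
  by rewrite expr1 -aE.
have ga : good a by have := (Ha 0).1 good0; rewrite add0r.
exact: ga.
Qed.
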